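(* Let $E,A\in\mathbb{R}^{n\times n}$, $B\in\mathbb{R}^{n\times m}$, $C\in\mathbb{R}^{m\times n}$, $D\in\mathbb{R}^{m\times m}$ be given, defining the system $(E,A,B,C,D)$: $E\dot x=Ax+Bu$, $y=Cx+Du$. Define $$\mathcal{F}(\tilde A,\tilde B,\tilde C,\tilde D,\tilde E)=\|A-\tilde A\|_F^2+\|B-\tilde B\|_F^2+\|C-\tilde C\|_F^2+\|D-\tilde D\|_F^2+\|E-\tilde E\|_F^2 .$$ Then the infimum $$\inf_{(M,(J-R)Q,F-P,(F+P)^TQ,S+N)\in\overline{\mathbb{S}_{PH}}}\ \mathcal{F}\big((J-R)Q,\,F-P,\,(F+P)^TQ,\,S+N,\,M\big)$$ coincides with $$\inf_{(\tilde E,\tilde A,\tilde B,\tilde C,\tilde D)\in\mathbb{S}_e}\mathcal{F}(\tilde A,\tilde B,\tilde C,\tilde D,\tilde E),$$ and it is an upper bound for $$\inf_{(\tilde E,\tilde A,\tilde B,\tilde C,\tilde D)\in\mathbb{S}}\mathcal{F}(\tilde A,\tilde B,\tilde C,\tilde D,\tilde E).$$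
   Context: $\|\cdot\|_F$ is the Frobenius norm. All systems below are quintuples of real matrices $(\tilde E,\tilde A,\tilde B,\tilde C,\tilde D)$ of the same sizes as $(E,A,B,C,D)$, i.e. $\tilde E,\tilde A\in\mathbb{R}^{n\times n}$, $\tilde B\in\mathbb{R}^{n\times m}$, $\tilde C\in\mathbb{R}^{m\times n}$, $\tilde D\in\mathbb{R}^{m\times m}$. For a real symmetric (or complex Hermitian) matrix, $\succ0$ (resp. $\succeq0$) means positive definite (resp. semidefinite); writing $M\succeq0$ for a real matrix includes the requirement that $M$ is symmetric. $j$ is the imaginary unit and ${}^*$ the conjugate transpose. The set $\overline{\mathbb{S}_{PH}}$ is the set of all systems $(M,(J-R)Q,F-P,(F+P)^TQ,S+N)$ with $M,J,R,Q\in\mathbb{R}^{n\times n}$, $F,P\in\mathbb{R}^{n\times m}$, $S,N\in\mathbb{R}^{m\times m}$, $J^T=-J$, $N^T=-N$, $M^TQ\succeq0$ and $\begin{bmatrix} R&P\\P^T&S\end{bmatrix}\succeq0$ ($Q$ is allowed to be singular). Regularity and admissibility. A pair $(\tilde E,\tilde A)$ (and the system) is regular if $\det(\lambda\tilde E-\tilde A)\neq0$ for some $\lambda\in\mathbb{C}$; its finite eigenvalues are then the roots of $\det(z\tilde E-\tilde A)$. A regular pair has a Weierstrass canonical form $\tilde E=W\begin{bmatrix} I_q&0\\0&N_0\end{bmatrix}T$, $\tilde A=W\begin{bmatrix} J_0&0\\0&I_{n-q}\end{bmatrix}T$ with $W,T\in\mathbb{C}^{n\times n}$ nonsingular, $J_0$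 in Jordan form and $N_0$ nilpotent in Jordan form; its index is the degree of nilpotency of $N_0$ if $q<n$, and $0$ if $\tilde E$ is nonsingular. The system is admissible if $(\tilde E,\tilde A)$ is regular, of index at most one, and all its finite eigenvalues lie in the open left half plane. Positive realness. For a regular system let $G(s)=\tilde C(s\tilde E-\tilde A)^{-1}\tilde B+\tilde D$. The system is positive real (PR) if $G$ has no pole in $\{\mathrm{Re}\,s>0\}$ and $G(s)+G(s)^*\succeq0$ for all $s$ with $\mathrm{Re}\,s>0$. It is strictly positive real (SPR) if $G$ has no pole in $\{\mathrm{Re}\,s\ge0\}$ and $G(jw)+G(jw)^*\succ0$ for all $w\in[0,\infty)$. It is extended strictly positive real (ESPR) if it is SPR and $G(j\infty)+G(j\infty)^*\succ0$, where $G(j\infty)=\lim_{w\to\infty}G(jw)$. $\mathbb{S}$ is the set of all PR systems (which in particular are regular). $\mathbb{S}_e$ is the set of all admissible ESPR systems $(\tilde E,\tilde A,\tilde B,\tilde C,\tilde D)$ with $\tilde D+\tilde D^T\succ0$. *)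

(* Defs.v *)
From HB Require Import structures.
From mathcomp Require Import all_boot all_order all_algebra.
From mathcomp Require Import generic_quotient fraction complex.
From mathcomp Require Import boolp classical_sets reals ereal topology normedtype.

Set Implicit Arguments.
Unset Strict Implicit.
Unset Printing Implicit Defensive.

Import Order.TTheory GRing.Theory Num.Theory.
Import numFieldNormedType.Exports.

Local Open Scope classical_set_scope.
Local Open Scope complex_scope.
Local Open Scope sesquilinear_scope.
Local Open Scope ring_scope.

(* Systems E x' = A x + B u, y = C x + D u. *)
Record system (R : Type) (n m : nat) := System {
  sysE : 'M[R]_n;
  sysA : 'M[R]_n;
  sysB : 'M[R]_(n, m);
  sysC : 'M[R]_(m, n);
  sysD : 'M[R]_m }.

Definition psdmx (R : realType) n (M : 'M[R]_n) : Prop :=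
  M^T = M /\ forall x : 'cV[R]_n, 0 <= (x^T *m M *m x) 0 0.

Definition pdmx (R : realType) n (M : 'M[R]_n) : Prop :=
  M^T = M /\ forall x : 'cV[R]_n, x != 0 -> 0 < (x^T *m M *m x) 0 0.

(* In R[i], 0 <= z (resp. 0 < z) means that z is real and nonnegative
   (resp. real and positive). *)
Definition hpsdmx (R : realType) n (M : 'M[R[i]]_n) : Prop :=
  M ^t* = M /\ forall x : 'cV[R[i]]_n, 0 <= (x ^t* *m M *m x) 0 0.

Definition hpdmx (R : realType) n (M : 'M[R[i]]_n) : Prop :=
  M ^t* = M /\
  forall x : 'cV[R[i]]_n, x != 0 -> 0 < (x ^t* *m M *m x) 0 0.

Definition frobenius (R : realType) m n (M : 'M[R]_(m, n)) : R :=
  Num.sqrt (\sum_i \sum_j M i j ^+ 2).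

Definition cplxmx (R : realType) m n (M : 'M[R]_(m, n)) : 'M[R[i]]_(m, n) :=
  map_mx (real_complex R) M.

Section Pencil.
Context {R : realType} {n : nat}.
Implicit Types E A : 'M[R]_n.

Definition regular_pencil E A : Prop :=
  exists z : R[i], \det (z *: cplxmx E - cplxmx A) != 0.

Definition finite_eigenvalue E A (z : R[i]) : Prop :=
  \det (z *: cplxmx E - cplxmx A) = 0.

(* Jordan blocks have their ones on the superdiagonal. *)
Definition jordan_form k (J : 'M[R[i]]_k) : Prop :=
  forall i j : 'I_k,
    ((j : nat) = i.+1 -> J i j = 0 \/ (J i j = 1 /\ J i i = J j j)) /\
    ((j : nat) <> i -> (j : nat) <> i.+1 -> J i j = 0).

Definition nilpotency_degree k (N : 'M[R[i]]_k) (d : nat) : Prop :=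
  N ^+ d = 0 /\ forall l, (l < d)%N -> N ^+ l <> 0.

Definition weierstrass_form E A q r (eqn : (q + r)%N = n)
    (W T : 'M[R[i]]_n) (J0 : 'M[R[i]]_q) (N0 : 'M[R[i]]_r) : Prop :=
  [/\ W \in unitmx, T \in unitmx, jordan_form J0,
      jordan_form N0 /\ (exists d, N0 ^+ d = 0) &
      cplxmx E = W *m castmx (eqn, eqn) (block_mx 1%:M 0 0 N0) *m T /\
      cplxmx A = W *m castmx (eqn, eqn) (block_mx J0 0 0 1%:M) *m T].

(* q = n exactly when E is nonsingular. *)
Definition pencil_index E A (k : nat) : Prop :=
  exists (q r : nat) (eqn : (q + r)%N = n) (W T : 'M[R[i]]_n)
         (J0 : 'M[R[i]]_q) (N0 : 'M[R[i]]_r),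
    weierstrass_form E A eqn W T J0 N0 /\
    (if (q < n)%N then nilpotency_degree N0 k else k = 0).

Definition admissible_pencil E A : Prop :=
  [/\ regular_pencil E A,
      exists2 k, pencil_index E A k & (k <= 1)%N &
      forall z, finite_eigenvalue E A z -> complex.Re z < 0].

End Pencil.

Local Notation "p %:F" := (@FracField.tofrac _ p).

(* Rational functions are elements of the fraction field of {poly R[i]}; poles
   and values are read off from a representation in lowest terms, so that
   removable singularities of a rational expression are not poles. *)
Section RationalFunctions.
Context {R : realType}.
Implicit Types (g : {fraction {poly R[i]}}) (s : R[i]).

Definition rat_num g : {poly R[i]} :=
  let x := repr g in \n_x %/ gcdp \n_x \d_x.

Definition rat_den g : {poly R[i]} :=
  let x := repr g in \d_x %/ gcdp \n_x \d_x.

Definition rat_eval g s : R[i] := (rat_num g).[s] / (rat_den g).[s].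

Definition mx_pole m (G : 'M[{fraction {poly R[i]}}]_m) s : Prop :=
  exists i j, root (rat_den (G i j)) s.

Definition mx_eval m (G : 'M[{fraction {poly R[i]}}]_m) s : 'M[R[i]]_m :=
  map_mx (fun g => rat_eval g s) G.

End RationalFunctions.

(* R[i] with its canonical topology, which is attached to the numFieldType. *)
Definition cplx_num (R : realType) : numFieldType := R[i].

Section Systems.
Context {R : realType} {n m : nat}.
Implicit Types sys : system R n m.

Definition const_fracmx p q (M : 'M[R]_(p, q)) :
    'M[{fraction {poly R[i]}}]_(p, q) :=
  map_mx (fun x : R => (x%:C)%:P%:F) M.

(* G(s) = C (s E - A)^-1 B + D with the variable s := 'X; the matrix s E - A is
   invertible over the field of rational functions when (E, A) is regular. *)
Definition transfer_function sys : 'M[{fraction {poly R[i]}}]_m :=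
  const_fracmx (sysC sys)
    *m invmx ('X%:F *: const_fracmx (sysE sys) - const_fracmx (sysA sys))
    *m const_fracmx (sysB sys) + const_fracmx (sysD sys).

Definition add_ctr (M : 'M[R[i]]_m) : 'M[R[i]]_m := M + M ^t*.

Definition regular_system sys : Prop := regular_pencil (sysE sys) (sysA sys).

Definition admissible_system sys : Prop :=
  admissible_pencil (sysE sys) (sysA sys).

Definition positive_real sys : Prop :=
  let G := transfer_function sys in
  [/\ regular_system sys,
      forall s, 0 < complex.Re s -> ~ mx_pole G s &
      forall s, 0 < complex.Re s -> hpsdmx (add_ctr (mx_eval G s))].

Definition strictly_positive_real sys : Prop :=
  let G := transfer_function sys in
  [/\ regular_system sys,
      forall s, 0 <= complex.Re s -> ~ mx_pole G s &
      forall w : R, 0 <= w -> hpdmx (add_ctr (mx_eval G (0 +i* w)))].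

Definition extended_strictly_positive_real sys : Prop :=
  let G := transfer_function sys in
  strictly_positive_real sys /\
  exists2 Ginf : 'M[cplx_num R]_m,
    (mx_eval G (0 +i* w) : 'M[cplx_num R]_m) @[w --> +oo%R] --> Ginf &
    hpdmx (add_ctr Ginf).

Definition S_PHbar : set (system R n m) :=
  [set sys | exists (M J Rm Q : 'M[R]_n) (F P : 'M[R]_(n, m)) (S N : 'M[R]_m),
    [/\ J^T = - J, N^T = - N, psdmx (M^T *m Q), psdmx (block_mx Rm P P^T S) &
        sys = System M ((J - Rm) *m Q) (F - P) ((F + P)^T *m Q) (S + N)]].

Definition S_PR : set (system R n m) := [set sys | positive_real sys].

Definition S_e : set (system R n m) :=
  [set sys | [/\ admissible_system sys, extended_strictly_positive_real sys &
                 pdmx (sysD sys + (sysD sys)^T)]].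

End Systems.

(* Main.v *)
Require Import Defs.
From mathcomp Require Import all_boot all_order all_algebra zify ring lra.
From mathcomp Require Import generic_quotient fraction separable complex.
From mathcomp Require Import boolp classical_sets reals ereal topology normedtype.

Set Implicit Arguments.
Unset Strict Implicit.
Unset Printing Implicit Defensive.

Import Order.TTheory GRing.Theory Num.Theory.
Import numFieldNormedType.Exports.

Local Open Scope classical_set_scope.
Local Open Scope sesquilinear_scope.
Local Open Scope ring_scope.

(* Two perturbation arguments give the equality of the infima.

   From S_e to port-Hamiltonian systems, only D is perturbed, into D + t.  In
   Weierstrass coordinates the index-one pencil splits into a stable standard
   system with feedthrough Dr = G(j oo) and an algebraic constraint
   x2 + B2 u = 0.  The positive real lemma for the standard part comes from the
   stable invariant subspace of its Hamiltonian matrix: the stable and the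
   antistable subspaces are both isotropic, hence both of dimension n, and the
   stable one is the graph of a solution of the Riccati equation.  A multiplier
   for the constraint turns this solution into a strict dissipation inequality
   for the descriptor system, and the real part Q of the resulting matrix gives
   the port-Hamiltonian form.

   In the other direction, small changes of (M, Q), then R, S, then J, R make Q
   and M invertible, the dissipation matrix positive definite and the spectrum
   of M^-1 (J - R) Q simple.  The energy identity then shows that the system is
   admissible, ESPR and PR, which also yields the bound for S. *)

(** Strictness carries the first direction. The port-Hamiltonian matrices are read off from
    [A *m invmx X], so the multiplier [X] has to be invertible. It is first found over the complex
    numbers, because Weierstrass coordinates are complex. The real part of an invertible matrix may
    be singular, but a strict dissipation inequality survives taking real parts and forces
    invertibility. The margin [t] added to D pays for this: it covers the Lyapunov term that makes
    the inequality strict in the state, and the cross terms between constraint and input. The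
    positive real lemma assumes no controllability: stability and strict positivity on the imaginary
    axis take its place.

    In the other direction each perturbation follows a straight line of systems. The objective is
    quadratic in the step size there, so arbitrarily small steps suffice to compare infima. The
    simple spectrum gives an explicit Weierstrass form, with diagonal J0 and an empty nilpotent
    block. *)

(** * Conjugate transposes and the Riccati equation *)

Section ConjTranspose.
Context {C : numClosedFieldType}.

Lemma ctmxM m n p (A : 'M[C]_(m, n)) (B : 'M[C]_(n, p)) :
  (A *m B) ^t* = B ^t* *m A ^t*.
Proof. by rewrite trmx_mul map_mxM. Qed.

Lemma ctmxD m n (A B : 'M[C]_(m, n)) : (A + B) ^t* = A ^t* + B ^t*.
Proof. by rewrite linearD /= map_mxD. Qed.

Lemma ctmxN m n (A : 'M[C]_(m, n)) : (- A) ^t* = - A ^t*.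
Proof. by rewrite linearN /= map_mxN. Qed.

Lemma ctmxB m n (A B : 'M[C]_(m, n)) : (A - B) ^t* = A ^t* - B ^t*.
Proof. by rewrite ctmxD ctmxN. Qed.

Lemma ctmxZ m n a (A : 'M[C]_(m, n)) : (a *: A) ^t* = a^* *: A ^t*.
Proof. by rewrite linearZ /= map_mxZ. Qed.

Lemma ctmx0 m n : (0 : 'M[C]_(m, n)) ^t* = 0.
Proof. by rewrite trmx0 map_mx0. Qed.

Lemma ctmx1 n : (1%:M : 'M[C]_n) ^t* = 1%:M.
Proof. by rewrite trmx1 map_mx1. Qed.

Lemma ctmx_row m n p (A : 'M[C]_(m, n)) (B : 'M[C]_(m, p)) :
  (row_mx A B) ^t* = col_mx (A ^t*) (B ^t*).
Proof. by rewrite tr_row_mx map_col_mx. Qed.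

Lemma ctmx_col m n p (A : 'M[C]_(m, p)) (B : 'M[C]_(n, p)) :
  (col_mx A B) ^t* = row_mx (A ^t*) (B ^t*).
Proof. by rewrite tr_col_mx map_row_mx. Qed.

Lemma ctmx_block m n p q (A : 'M[C]_(m, p)) B D (E : 'M[C]_(n, q)) :
  (block_mx A B D E) ^t* = block_mx (A ^t*) (D ^t*) (B ^t*) (E ^t*).
Proof. by rewrite tr_block_mx map_block_mx. Qed.

Lemma ctmx_inv n (A : 'M[C]_n) : (invmx A) ^t* = invmx (A ^t*).
Proof. by rewrite trmx_inv map_invmx. Qed.

End ConjTranspose.

(** * Root subspaces and the spectral splitting off the imaginary axis *)

Section Annihilator.
Context {C : numClosedFieldType}.

(** A product over a list lets proofs peel off one factor at a time and allows size 0. With each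
    eigenvalue listed as often as its multiplicity, the left kernel is the sum of the root
    subspaces. *)
Definition annihilator k (N : 'M[C]_k) (s : seq C) : 'M[C]_k :=
  \big[mulmx/1%:M]_(l <- s) (N - l%:M).

Lemma annihilator_cons k (N : 'M[C]_k) l s :
  annihilator N (l :: s) = (N - l%:M) *m annihilator N s.
Proof. by rewrite /annihilator big_cons. Qed.

Lemma annihilator_horner k (N : 'M[C]_k.+1) (s : seq C) :
  annihilator N s = horner_mx N (\prod_(l <- s) ('X - l%:P)).
Proof.
rewrite rmorph_prod /=; apply: eq_bigr => l _.
by rewrite rmorphB /= horner_mx_X horner_mx_C.
Qed.

Lemma annihilator_comm k (N : 'M[C]_k) s :
  annihilator N s *m N = N *m annihilator N s.
Proof.
elim: s => [|l s IH]; first by rewrite /annihilator big_nil mulmx1 mul1mx.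
rewrite annihilator_cons -mulmxA IH !mulmxA; congr (_ *m _).
by rewrite mulmxBl mulmxBr scalar_mxC.
Qed.

(** No root of the characteristic polynomial is imaginary, so it is a product of a stable and an
    antistable factor, which are coprime. By Cayley-Hamilton their kernels together span the whole
    space. *)
Lemma spectral_splitting k (N : 'M[C]_k) :
  (forall l (v : 'rV_k), l + l^* = 0 -> v *m N = l *: v -> v = 0) ->
  exists s t : seq C,
    [/\ {in s, forall l, l + l^* < 0}, {in t, forall l, 0 < l + l^*} &
        (k <= \rank (kermx (annihilator N s))
              + \rank (kermx (annihilator N t)))%N].
Proof.
case: k N => [|k] N hN; first by exists [::], [::]; split.
have [r hr] := closed_field_poly_normal (char_poly N).
rewrite (monicP (char_poly_monic N)) scale1r in hr.
pose p := [pred l : C | l + l^* < 0].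
have r_real (l : C) : l + l^* \is Num.real.
  by apply/CrealP; rewrite rmorphD /= conjCK addrC.
have r_pos (l : C) : l \in r -> ~~ p l -> 0 < l + l^*.
  move=> lr /=; case: (real_ltgtP (r_real l) (real0 C)) => // h0.
  have : eigenvalue N l by rewrite eigenvalue_root_char hr root_prod_XsubC.
  by case/eigenvalueP => v /hN -> //; rewrite eqxx.
exists [seq l <- r | p l], [seq l <- r | ~~ p l]; split.
- by move=> l; rewrite mem_filter => /andP[].
- by move=> l; rewrite mem_filter => /andP[/= hl /r_pos]; apply.
rewrite !annihilator_horner.
set ps := \prod_(l <- [seq l <- r | p l]) _.
set pt := \prod_(l <- [seq l <- r | ~~ p l]) _.
have hst : coprimep ps pt.
  rewrite /pt big_seq; apply: (big_rec (coprimep ps)) => [|l q].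
    exact: coprimep1.
  rewrite mem_filter => /andP[/= hl _] hq; rewrite coprimepMr hq andbT.
  by rewrite coprimep_XsubC root_prod_XsubC mem_filter negb_and hl.
have := kermxpolyM N hst.
have -> : ps * pt = char_poly N.
  by rewrite hr /ps /pt !big_filter [RHS](bigID p).
rewrite /kermxpoly Cayley_Hamilton => h.
have {1}<- : \rank (1%:M : 'M[C]_k.+1) = k.+1 by rewrite mxrank1.
have <- : \rank (kermx (0 : 'M[C]_k.+1)) = \rank (1%:M : 'M[C]_k.+1).
  by rewrite kermx0.
by rewrite h mxrank_adds_leqif.
Qed.

End Annihilator.

Section Riccati.
Context {C : numClosedFieldType} {n : nat}.
Implicit Types (A R Q : 'M[C]_n).

(* The conjugate transpose of the Hamiltonian matrix [[A, R], [-Q, -A^*]]. *)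
Definition hamiltonian A R Q : 'M[C]_(n + n) := block_mx (A ^t*) (- Q) R (- A).

Definition symplectic : 'M[C]_(n + n) := block_mx 0 1%:M (- 1%:M) 0.

(** The Hamiltonian is skew-adjoint for the form given by [symplectic]: it moves from one argument
    to the other at the cost of a sign. Hence eigenvalues [l] and [m] can pair nontrivially only if
    [l + m^* = 0]. *)
Lemma hamiltonian_symplectic A R Q : R ^t* = R -> Q ^t* = Q ->
  hamiltonian A R Q *m symplectic
  = - (symplectic *m (hamiltonian A R Q) ^t*).
Proof.
move=> hR hQ; rewrite /hamiltonian /symplectic ctmx_block !mulmx_block.
rewrite opp_block_mx trmxCK !ctmxN hR hQ.
rewrite !(mulmx0, mul0mx, add0r, addr0, mulmxN, mulNmx, mulmx1, mul1mx, opprK).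
by [].
Qed.

(* If the spectra [s] and [t] avoid each other's reflections in the imaginary
   axis, then the corresponding root subspaces are symplectically orthogonal. *)
Lemma annihilator_isotropic A R Q k1 k2 (s t : seq C) (a : 'M[C]_(k1, n + n))
    (b : 'M[C]_(k2, n + n)) :
  R ^t* = R -> Q ^t* = Q ->
  {in s & t, forall l m, l + m^* != 0} ->
  a *m annihilator (hamiltonian A R Q) s = 0 ->
  b *m annihilator (hamiltonian A R Q) t = 0 ->
  a *m symplectic *m b ^t* = 0.
Proof.
move=> hR hQ; set N := hamiltonian A R Q.
have [k] := ubnP (size s + size t)%N.
elim: k s t a b => // k IH [|l s] t a b.
  by move=> _ _; rewrite /annihilator big_nil mulmx1 => ->; rewrite !mul0mx.
case: t => [|m t].
  by move=> _ _ _; rewrite /annihilator big_nil mulmx1 => ->; rewrite ctmx0 mulmx0.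
move=> hk hst ha hb.
(* By induction [a *m (N - l%:M)] is already orthogonal to [b], so against [b] the row [a] behaves
   like an eigenvector for [l]; [hm] does the same for [b] and [m]. *)
have hl : a *m N *m symplectic *m b ^t* = l *: (a *m symplectic *m b ^t*).
  have /eqP : a *m (N - l%:M) *m symplectic *m b ^t* = 0.
    apply: (IH s (m :: t)) => //; last first.
      by rewrite -mulmxA; move: ha; rewrite annihilator_cons.
    by move=> x y xs ys; apply: hst => //; rewrite inE xs orbT.
  by rewrite mulmxBr mul_mx_scalar !mulmxBl -!scalemxAl subr_eq0 => /eqP.
have hm : a *m symplectic *m (b *m N) ^t* = m^* *: (a *m symplectic *m b ^t*).
  have /eqP : a *m symplectic *m (b *m (N - m%:M)) ^t* = 0.
    apply: (IH (l :: s) t) => //.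
    - by move: hk; rewrite /= addnS ltnS.
    - by move=> x y xs ys; apply: hst => //; rewrite inE ys orbT.
    - by rewrite -mulmxA; move: hb; rewrite annihilator_cons.
  by rewrite mulmxBr mul_mx_scalar ctmxB ctmxZ mulmxBr -scalemxAr subr_eq0 => /eqP.
have /eqP : (l + m^*) *: (a *m symplectic *m b ^t*) = 0.
  rewrite scalerDl -hl -hm ctmxM -[a *m N *m _]mulmxA hamiltonian_symplectic //.
  by rewrite mulmxN mulNmx !mulmxA addNr.
rewrite scaler_eq0 => /orP[|/eqP //].
by rewrite (negPf (hst _ _ _ _)) ?mem_head.
Qed.

(** As [symplectic] is invertible, both factors of the vanishing product have the rank of [V], and
    these ranks add up to at most [n + n]. *)
Lemma isotropic_rank k (V : 'M[C]_(k, n + n)) :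
  V *m symplectic *m V ^t* = 0 -> (\rank V <= n)%N.
Proof.
move=> hV; have hunit : symplectic \in unitmx.
  have h : symplectic *m (- symplectic) = 1%:M.
    rewrite /symplectic opp_block_mx mulmx_block.
    rewrite !(mulmx0, mul0mx, add0r, addr0, mulmxN, mulNmx, mulmx1, oppr0).
    by rewrite opprK -scalar_mx_block.
  by case/mulmx1_unit: h.
have := mulmx0_rank_max hV.
rewrite mxrankMfree ?row_free_unit // mxrank_map mxrank_tr.
by lia.
Qed.

(** The stable root subspace is the row space of [row_mx 1%:M X]: isotropy makes [X] Hermitian, and
    invariance under the Hamiltonian is the Riccati equation. The conditions on [R] and on the left
    eigenvectors of [A] (stabilizability) exclude vertical vectors [row_mx 0 b], so that the
    subspace is a graph. *)
Theorem riccati_exists A R Q : R ^t* = R -> Q ^t* = Q ->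
  (forall b : 'rV_n, b *m R *m b ^t* = 0 -> b *m R = 0) ->
  (forall l (b : 'rV_n), 0 <= l + l^* -> b *m R = 0 -> b *m A = l *: b ->
     b = 0) ->
  (forall l (v : 'rV_(n + n)), l + l^* = 0 ->
     v *m hamiltonian A R Q = l *: v -> v = 0) ->
  exists2 X : 'M[C]_n, X ^t* = X &
    A ^t* *m X + X *m A + X *m R *m X + Q = 0.
Proof.
move=> hR hQ R0 Astab himag.
have [s [t [hs ht]]] := spectral_splitting himag.
set N := hamiltonian A R Q in himag *.
set K := kermx (annihilator N s); set K' := kermx _.
have K_ann : K *m annihilator N s = 0 by apply: mulmx_ker.
have K'_ann : K' *m annihilator N t = 0 by apply: mulmx_ker.
have K_iso k1 k2 (a : 'M_(k1, n + n)) (b : 'M_(k2, n + n)) :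
    a *m annihilator N s = 0 -> b *m annihilator N s = 0 ->
    a *m symplectic *m b ^t* = 0.
  apply: annihilator_isotropic => // l m /hs hl /hs hm.
  apply/negP => /eqP h; have : l + l^* + (m + m^*) < 0 by rewrite -[ltRHS]addr0 ltrD.
  have -> : l + l^* + (m + m^*) = (l + m^*) + (l + m^*)^*.
    by rewrite rmorphD /= conjCK; ring.
  by rewrite h conjC0 addr0 ltxx.
have K'_iso : K' *m symplectic *m K' ^t* = 0.
  apply: (annihilator_isotropic hR hQ _ K'_ann K'_ann) => l m /ht hl /ht hm.
  apply/negP => /eqP h; have : 0 < l + l^* + (m + m^*) by rewrite addr_gt0.
  have -> : l + l^* + (m + m^*) = (l + m^*) + (l + m^*)^*.
    by rewrite rmorphD /= conjCK; ring.
  by rewrite h conjC0 addr0 ltxx.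
move=> hrank.
(* The antistable subspace is isotropic, so it takes at most [n] of the [n + n] dimensions and
   leaves at least [n] to [K]. *)
have rK : (n <= \rank K)%N.
  have := isotropic_rank K'_iso; move: hrank; rewrite -/K => h1 h2.
  by rewrite -(leq_add2r n); apply: (leq_trans h1); rewrite leq_add2l.
(* Pairing a vertical vector with its image under [N] gives [c *m R *m c ^t* = 0], hence
   [c *m R = 0]. Thus the vertical part of the stable subspace is invariant and [N] acts on it as
   [- A]; an eigenvector there contradicts stabilizability. *)
have graph0 (b : 'rV_n) : row_mx 0 b *m annihilator N s = 0 -> b = 0.
  have step (c : 'rV_n) l : row_mx 0 c *m annihilator N s = 0 ->
      c *m R = 0 /\ row_mx 0 c *m (N - l%:M) = - row_mx 0 (c *m (A + l%:M)).
    move=> hc.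
    have cN : row_mx 0 c *m N = row_mx (c *m R) (- (c *m A)).
      by rewrite /N /hamiltonian mul_row_block !mul0mx !add0r mulmxN.
    have cR : c *m R = 0.
      apply: R0; have := K_iso _ _ (row_mx 0 c) (row_mx 0 c *m N) hc.
      rewrite -mulmxA -annihilator_comm mulmxA hc mul0mx => /(_ erefl).
      rewrite cN /symplectic mul_row_block ctmx_row mul_row_col.
      rewrite !(mulmx0, mul0mx, add0r, addr0, mulmxN, mulNmx, mulmx1).
      rewrite ctmxM hR mulmxA => /eqP; rewrite oppr_eq0 => /eqP.
      by [].
    split=> //; rewrite mulmxBr cN cR mul_mx_scalar scale_row_mx scaler0.
    rewrite opp_row_mx add_row_mx subr0 mulmxDr mul_mx_scalar -opprD.
    by rewrite opp_row_mx oppr0.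
  (* The list [u] shrinks while annihilation by all of [s] is kept, since [step] relies on isotropy
     of the whole stable subspace. *)
  suff H u : {subset u <= s} -> row_mx 0 b *m annihilator N u = 0 ->
      row_mx 0 b *m annihilator N s = 0 -> b = 0 by move=> h; apply: (H s).
  elim: u b => [|l u IH] b us.
    rewrite /annihilator big_nil mulmx1 -row_mx0 => /eq_row_mx[_ ->//].
  rewrite annihilator_cons mulmxA => h1 h2.
  have [bR bN] := step b l h2.
  have ls : l \in s by rewrite us ?mem_head.
  have : b *m (A + l%:M) = 0.
    apply: IH => [x xu||]; first by rewrite us // inE xu orbT.
      by move: h1; rewrite bN mulNmx => /eqP; rewrite oppr_eq0 => /eqP.
    apply: oppr_inj; rewrite oppr0 -mulNmx -bN -mulmxA.
    rewrite mulmxBl mul_scalar_mx -annihilator_comm -mul_mx_scalar -mulmxBr.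
    by rewrite mulmxA h2 mul0mx.
  rewrite mulmxDr mul_mx_scalar => /eqP; rewrite addr_eq0 => /eqP.
  rewrite -scaleNr => /Astab; apply=> //.
  by rewrite rmorphN /= -opprD oppr_ge0 ltW ?hs.
have graphM k (a : 'M_(k, n + n)) :
    a *m annihilator N s = 0 -> lsubmx a = 0 -> a = 0.
  move=> ha ha0; apply/row_matrixP => i; rewrite row0.
  rewrite -[a]hsubmxK ha0 row_row_mx row0.
  rewrite (graph0 (row i (rsubmx a))) ?row_mx0 //.
  move: (congr1 (row i) ha); rewrite row_mul -{1}[a]hsubmxK ha0 row_row_mx row0.
  by rewrite row0.
have lK_full : row_full (lsubmx K).
  rewrite /row_full eqn_leq rank_leq_col; apply: (leq_trans rK).
  have : (kermx (lsubmx K) <= kermx K)%MS.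
    apply/sub_kermxP; apply: graphM; first by rewrite -mulmxA K_ann mulmx0.
    by rewrite -mulmx_lsub mulmx_ker.
  move/mxrankS; rewrite !mxrank_ker; have := rank_leq_row K.
  by have := rank_leq_row (lsubmx K); lia.
have /row_fullP[L hL] := lK_full.
pose X := L *m rsubmx K.
have LK : L *m K = row_mx 1%:M X.
  by rewrite -[L *m K]hsubmxK -mulmx_lsub -mulmx_rsub hL.
have LK_ann : row_mx 1%:M X *m annihilator N s = 0.
  by rewrite -LK -mulmxA K_ann mulmx0.
have graph k (a : 'M_(k, n + n)) : a *m annihilator N s = 0 ->
    rsubmx a = lsubmx a *m X.
  move=> ha; apply/eqP; rewrite -subr_eq0.
  have /eqP : a - lsubmx a *m row_mx 1%:M X = 0.
    apply: graphM; first by rewrite mulmxBl ha -mulmxA LK_ann mulmx0 subr0.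
    by rewrite linearB /= mul_mx_row row_mxKl mulmx1 subrr.
  rewrite -{1}[a]hsubmxK mul_mx_row mulmx1 opp_row_mx add_row_mx subrr.
  by rewrite -row_mx0 => /eqP/eq_row_mx[_ ->].
have hX : X ^t* = X.
  have := K_iso _ _ _ _ LK_ann LK_ann.
  rewrite /symplectic mul_row_block ctmx_row mul_row_col ctmx1.
  rewrite !(mulmx0, mul1mx, add0r, addr0, mulmxN, mulmx1) => /eqP.
  by rewrite addrC subr_eq0 => /eqP.
exists X => //.
(* The image of the graph under [N] lies in the graph again; comparing its two blocks is the Riccati
   equation. *)
have : row_mx 1%:M X *m N *m annihilator N s = 0.
  by rewrite -mulmxA -annihilator_comm mulmxA LK_ann mul0mx.
move/graph.
rewrite /N /hamiltonian mul_row_block row_mxKr row_mxKl !mul1mx mulmxN mulmxDl.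
move=> /eqP; rewrite eq_sym -subr_eq0 => /eqP <-.
by rewrite opprD !opprK [Q + _]addrC addrA; congr (_ + _); rewrite addrAC.
Qed.

End Riccati.

(** * The positive real lemma *)

Section ConjDot.
Context {C : numClosedFieldType}.

Definition cdot n (x y : 'cV[C]_n) : C := (x ^t* *m y) 0 0.

Definition re2 (z : C) : C := z + z^*.

Lemma cdotE n (x y : 'cV[C]_n) : cdot x y = \sum_i (x i 0)^* * y i 0.
Proof. by rewrite /cdot mxE; apply: eq_bigr => i _; rewrite !mxE. Qed.

Lemma cdotDl n (x y z : 'cV[C]_n) : cdot (x + y) z = cdot x z + cdot y z.
Proof. by rewrite /cdot ctmxD mulmxDl mxE. Qed.

Lemma cdotDr n (x y z : 'cV[C]_n) : cdot z (x + y) = cdot z x + cdot z y.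
Proof. by rewrite /cdot mulmxDr mxE. Qed.

Lemma cdotNl n (x y : 'cV[C]_n) : cdot (- x) y = - cdot x y.
Proof. by rewrite /cdot ctmxN mulNmx mxE. Qed.

Lemma cdotNr n (x y : 'cV[C]_n) : cdot x (- y) = - cdot x y.
Proof. by rewrite /cdot mulmxN mxE. Qed.

Lemma cdotBl n (x y z : 'cV[C]_n) : cdot (x - y) z = cdot x z - cdot y z.
Proof. by rewrite cdotDl cdotNl. Qed.

Lemma cdotBr n (x y z : 'cV[C]_n) : cdot z (x - y) = cdot z x - cdot z y.
Proof. by rewrite cdotDr cdotNr. Qed.

Lemma cdotZl n a (x y : 'cV[C]_n) : cdot (a *: x) y = a^* * cdot x y.
Proof. by rewrite /cdot ctmxZ -scalemxAl mxE. Qed.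

Lemma cdotZr n a (x y : 'cV[C]_n) : cdot x (a *: y) = a * cdot x y.
Proof. by rewrite /cdot -scalemxAr mxE. Qed.

Lemma cdot0l n (x : 'cV[C]_n) : cdot 0 x = 0.
Proof. by rewrite /cdot ctmx0 mul0mx mxE. Qed.

Lemma cdot0r n (x : 'cV[C]_n) : cdot x 0 = 0.
Proof. by rewrite /cdot mulmx0 mxE. Qed.

Lemma cdotMl m n (A : 'M[C]_(m, n)) x y :
  cdot (A *m x) y = cdot x (A ^t* *m y).
Proof. by rewrite /cdot ctmxM mulmxA. Qed.

Lemma cdotC n (x y : 'cV[C]_n) : (cdot x y)^* = cdot y x.
Proof.
rewrite !cdotE rmorph_sum; apply: eq_bigr => i _.
by rewrite rmorphM /= conjCK mulrC.
Qed.

Lemma cdot_ge0 n (x : 'cV[C]_n) : 0 <= cdot x x.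
Proof. by rewrite cdotE sumr_ge0 // => i _; rewrite mulrC mul_conjC_ge0. Qed.

Lemma cdot_eq0 n (x : 'cV[C]_n) : (cdot x x == 0) = (x == 0).
Proof.
apply/eqP/eqP => [|->]; last exact: cdot0r.
rewrite cdotE => /psumr_eq0P h; apply/matrixP => i j; rewrite ord1 mxE.
apply/eqP; rewrite -mul_conjC_eq0 mulrC h // => k _.
by rewrite mulrC mul_conjC_ge0.
Qed.

Lemma cdot_gt0 n (x : 'cV[C]_n) : (0 < cdot x x) = (x != 0).
Proof. by rewrite lt_def cdot_ge0 andbT cdot_eq0. Qed.

Lemma cdot_col m n (x y : 'cV[C]_m) (z t : 'cV[C]_n) :
  cdot (col_mx x z) (col_mx y t) = cdot x y + cdot z t.
Proof. by rewrite /cdot ctmx_col mul_row_col mxE. Qed.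

Lemma re2_real z : re2 z \is Num.real.
Proof. by apply/CrealP; rewrite /re2 rmorphD /= conjCK addrC. Qed.

Lemma cdot_herm n (W : 'M[C]_n) x y : W ^t* = W ->
  (cdot x (W *m y))^* = cdot y (W *m x).
Proof. by move=> hW; rewrite cdotC cdotMl hW. Qed.

Lemma posdef_unit n (W : 'M[C]_n) :
  (forall x, x != 0 -> 0 < re2 (cdot x (W *m x))) -> W \in unitmx.
Proof.
move=> hW; rewrite -unitmx_tr -row_free_unit -kermx_eq0.
apply/rowV0P => v /sub_kermxP hv; apply/eqP/negPn/negP => v0.
have vT0 : v^T != 0 by apply: contraNneq v0 => h; rewrite -[v]trmxK h trmx0.
have := hW _ vT0; rewrite -[W *m _]trmxK trmx_mul trmxK hv trmx0 cdot0r.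
by rewrite /re2 conjC0 addr0 ltxx.
Qed.

End ConjDot.

Section KYP.
Context {C : numClosedFieldType} {n m : nat}.
Variables (A : 'M[C]_n) (B : 'M[C]_(n, m)) (Ct : 'M[C]_(m, n)) (D : 'M[C]_m).

Hypothesis A_stable : forall l, 0 <= l + l^* -> A - l%:M \in unitmx.

Lemma stable_right l (x : 'cV_n) : 0 <= l + l^* -> A *m x = l *: x -> x = 0.
Proof.
move=> hl hx; rewrite -[x](mulKmx (A_stable hl)) mulmxBl hx mul_scalar_mx.
by rewrite subrr mulmx0.
Qed.

Lemma stable_left l (x : 'rV_n) : 0 <= l + l^* -> x *m A = l *: x -> x = 0.
Proof.
move=> hl hx; rewrite -[x](mulmxK (A_stable hl)) mulmxBr hx mul_mx_scalar.
by rewrite subrr mul0mx.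
Qed.

Hypothesis D_pos : forall u, u != 0 -> 0 < re2 (cdot u (D *m u)).
Hypothesis freq_pos : forall l (x : 'cV_n) (u : 'cV_m), l + l^* = 0 ->
  l *: x = A *m x + B *m u -> u != 0 ->
  0 < re2 (cdot u (Ct *m x + D *m u)).

(** Completing the square in [u] with the weight [W = D + D ^t*] leaves a quadratic form in [x] that
    vanishes exactly when [X] solves the Riccati equation with the data [A'], [R], [Q] below. *)
Lemma kyp : exists2 X : 'M[C]_n, X ^t* = X &
  forall x u, re2 (cdot (X *m x) (A *m x + B *m u)
                   - cdot u (Ct *m x + D *m u)) <= 0.
Proof.
pose W := D + D ^t*.
have hW : W ^t* = W by rewrite /W ctmxD trmxCK addrC.
have W_form u : cdot u (W *m u) = re2 (cdot u (D *m u)).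
  by rewrite /re2 cdotC cdotMl -cdotDr -mulmxDl.
have W_pos u : u != 0 -> 0 < cdot u (W *m u) by rewrite W_form; exact: D_pos.
have W_ge0 u : 0 <= cdot u (W *m u).
  by have [->|/W_pos/ltW//] := eqVneq u 0; rewrite cdot0l.
have W_eq0 u : cdot u (W *m u) = 0 -> u = 0.
  by have [//|/W_pos] := eqVneq u 0 => + h; rewrite h ltxx.
have Wu : W \in unitmx.
  apply: posdef_unit => u /W_pos h.
  by rewrite /re2 cdot_herm // addr_gt0.
have hWi : (invmx W) ^t* = invmx W by rewrite ctmx_inv hW.
pose R := B *m invmx W *m B ^t*.
pose Q := Ct ^t* *m invmx W *m Ct.
pose A' := A - B *m invmx W *m Ct.
have hR : R ^t* = R by rewrite /R !ctmxM hWi trmxCK mulmxA.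
have hQ : Q ^t* = Q by rewrite /Q !ctmxM hWi trmxCK mulmxA.
have R0 (b : 'rV_n) : b *m R *m b ^t* = 0 -> b *m B = 0.
  move=> h; pose y := invmx W *m (b *m B) ^t*.
  have : y = 0.
    apply: W_eq0; rewrite /y mulKVmx // cdotMl hWi.
    by rewrite /cdot trmxCK ctmxM -!mulmxA !mulmxA -/R in h *; rewrite h mxE.
  move/(congr1 (mulmx W)); rewrite mulKVmx // mulmx0 => /(congr1 (fun M => M ^t*)).
  by rewrite trmxCK ctmx0.
have [X hX hric] : exists2 X : 'M[C]_n, X ^t* = X &
    A' ^t* *m X + X *m A' + X *m R *m X + Q = 0.
  apply: riccati_exists => //.
  - by move=> b /R0 h; rewrite /R !mulmxA h !mul0mx.
  - move=> l b hl bR bA; apply: (stable_left hl).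
    have bB : b *m B = 0 by apply: R0; rewrite bR mul0mx.
    by rewrite -bA /A' mulmxBr !mulmxA bB !mul0mx subr0.
  (* An imaginary eigenvector is read as a state [x] and a costate [p]; with the optimal input [u]
     they form a harmonic trajectory of zero supply. So [freq_pos] gives [u = 0], and stability then
     kills [x] and [p]. *)
  - move=> l v hl; rewrite -[v]hsubmxK.
    set a := lsubmx v; set c := rsubmx v => hv.
    pose x := a ^t*; pose p := c ^t*.
    pose u := invmx W *m (B ^t* *m p - Ct *m x).
    have Wu_eq : W *m u = B ^t* *m p - Ct *m x by rewrite mulKVmx.
    have hl' : l^* + l^*^* = 0 by rewrite conjCK addrC.
    have [h1 h2] : a *m A' ^t* + c *m R = l *: a /\ - (a *m Q) - c *m A' = l *: c.
      move: hv; rewrite /hamiltonian mul_row_block scale_row_mx !mulmxN.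
      by case/eq_row_mx.
    have hx : l^* *: x = A *m x + B *m u.
      rewrite -ctmxZ -h1 ctmxD [(a *m _) ^t*]ctmxM [(c *m _) ^t*]ctmxM.
      rewrite trmxCK hR -/x -/p /A' /R /u.
      by rewrite mulmxBl !mulmxBr -!mulmxA -addrA [- _ + _]addrC.
    have hp : A ^t* *m p = Ct ^t* *m u - l^* *: p.
      rewrite -ctmxZ -h2 ctmxB ctmxN [(a *m _) ^t*]ctmxM [(c *m _) ^t*]ctmxM.
      rewrite hQ -/x -/p /A' /Q /u ctmxB !ctmxM hWi mulmxBl !mulmxBr -!mulmxA.
      by rewrite [- (- _ - _)]opprD opprK opprK addrA subrK addrC subrK.
    have u0 : u = 0.
      apply/eqP/negPn/negP => u0; have := freq_pos hl' hx u0.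
      suff -> : re2 (cdot u (Ct *m x + D *m u)) = 0 by rewrite ltxx.
      have : cdot u (W *m u) = cdot u (B ^t* *m p) - cdot u (Ct *m x).
        by rewrite Wu_eq cdotBr.
      rewrite -cdotMl; have -> : B *m u = l^* *: x - A *m x.
        by rewrite hx addrAC subrr add0r.
      rewrite cdotBl cdotZl cdotMl hp cdotBr cdotZr W_form.
      have -> : cdot x (Ct ^t* *m u) = (cdot u (Ct *m x))^* by rewrite cdotC cdotMl.
      rewrite /re2 !cdotDr !rmorphD /= conjCK => h.
      rewrite addrACA h; transitivity ((l + l^*) * cdot x p); first ring.
      by rewrite hl mul0r.
    have x0 : x = 0.
      apply: (@stable_right (l^*)); first by rewrite hl'.
      by rewrite hx u0 mulmx0 addr0.
    have p0 : c = 0.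
      apply: (@stable_left (- l)); first by rewrite rmorphN /= -opprD hl oppr0.
      apply: (can_inj (@trmxCK _ _ _)).
      by rewrite ctmxM -/p hp u0 mulmx0 sub0r ctmxZ rmorphN /= scaleNr.
    have a0 : a = 0 by rewrite -[a]trmxCK -/x x0 ctmx0.
    by rewrite a0 p0 row_mx0.
exists X => // x u.
(* The maximizing input is [invmx W *m k], and [v] is the deviation from it. *)
pose k := (B ^t* *m X - Ct) *m x.
pose v := u - invmx W *m k.
suff -> : re2 (cdot (X *m x) (A *m x + B *m u) - cdot u (Ct *m x + D *m u))
          = - cdot v (W *m v) by rewrite oppr_le0.
have hAX : cdot (X *m x) (A *m x) + (cdot (X *m x) (A *m x))^*
    = - cdot k (invmx W *m k).
  have -> : cdot (X *m x) (A *m x) = cdot x (X *m A *m x).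
    by rewrite cdotMl hX mulmxA.
  have -> : (cdot x (X *m A *m x))^* = cdot x (A ^t* *m X *m x).
    by rewrite cdotC cdotMl ctmxM hX.
  have : cdot x ((A' ^t* *m X + X *m A' + X *m R *m X + Q) *m x) = 0.
    by rewrite hric mul0mx cdot0r.
  have hA' : A' ^t* = A ^t* - Ct ^t* *m invmx W *m B ^t*.
    by rewrite /A' ctmxB !ctmxM hWi mulmxA.
  have hk : (B ^t* *m X - Ct) ^t* = X *m B - Ct ^t*.
    by rewrite ctmxB ctmxM trmxCK hX.
  rewrite /k [cdot (_ *m x) _]cdotMl hk hA' /A' /R /Q.
  rewrite !(mulmxBl, mulmxBr, mulmxDl, mulmxDr, mulmxA, mulmxN, mulNmx).
  rewrite !(cdotDr, cdotBr, cdotNr) => h.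
  by apply: subr0_eq; rewrite -[RHS]h; ring.
have hku : cdot (X *m x) (B *m u) - (cdot u (Ct *m x))^* = cdot k u.
  rewrite cdotC /k mulmxBl cdotBl; congr (_ - _).
  by rewrite -mulmxA [in RHS]cdotMl trmxCK.
have -> : cdot v (W *m v) =
    cdot u (W *m u) - cdot u k - cdot k u + cdot k (invmx W *m k).
  rewrite /v mulmxBr mulKVmx // !(cdotBl, cdotBr) [cdot (invmx W *m k) _]cdotMl.
  by rewrite hWi mulKmx // [cdot (_ *m k) k]cdotMl hWi; ring.
rewrite -[cdot u k]cdotC -hku W_form /re2 !(cdotDr, rmorphB, rmorphD) /=.
rewrite conjCK.
transitivity (cdot (X *m x) (A *m x) + (cdot (X *m x) (A *m x))^*
  + cdot (X *m x) (B *m u) + (cdot (X *m x) (B *m u))^*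
  - cdot u (Ct *m x) - cdot u (D *m u)
  - (cdot u (Ct *m x))^* - (cdot u (D *m u))^*); first ring.
by rewrite hAX; ring.
Qed.

End KYP.

(** * Norm bounds, Lyapunov inequalities and the strict positive real lemma *)

Section Bounds.
Context {C : numClosedFieldType}.

Lemma re2D (y z : C) : re2 (y + z) = re2 y + re2 z.
Proof. by rewrite /re2 rmorphD addrACA. Qed.

Lemma re2N (z : C) : re2 (- z) = - re2 z.
Proof. by rewrite /re2 rmorphN opprD. Qed.

Lemma re2B (y z : C) : re2 (y - z) = re2 y - re2 z.
Proof. by rewrite re2D re2N. Qed.

Lemma re2_conj (z : C) : re2 z^* = re2 z.
Proof. by rewrite /re2 conjCK addrC. Qed.

Lemma re2_id (z : C) : z^* = z -> re2 z = 2 * z.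
Proof. by rewrite /re2 => ->; ring. Qed.

Lemma re2Zl (a z : C) : a^* = a -> re2 (a * z) = a * re2 z.
Proof. by move=> ha; rewrite /re2 rmorphM /= ha mulrDr. Qed.

Lemma cdot_cauchy n (x y : 'cV[C]_n) :
  cdot x y * cdot y x <= cdot x x * cdot y y.
Proof.
have [->|y0] := eqVneq y 0; first by rewrite !cdot0r !mulr0 mul0r.
have y_gt0 : 0 < cdot y y by rewrite cdot_gt0.
have := cdot_ge0 (cdot y y *: x - cdot y x *: y).
rewrite !(cdotBl, cdotBr, cdotZl, cdotZr) !cdotC => h.
rewrite -subr_ge0 -(pmulr_rge0 _ y_gt0) (le_trans h) // le_eqVlt; apply/orP; left.
by apply/eqP; ring.
Qed.

Lemma mulmx_bounded m n (M : 'M[C]_(m, n)) :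
  exists2 k : C, 0 < k & forall x, cdot (M *m x) (M *m x) <= k * cdot x x.
Proof.
pose k := \sum_i cdot ((row i M) ^t*) ((row i M) ^t*).
have k_ge0 : 0 <= k by apply: sumr_ge0 => i _; apply: cdot_ge0.
exists (1 + k) => [|x]; first by rewrite ltr_pwDl.
rewrite mulrDl mul1r; apply: (@le_trans _ _ (k * cdot x x)); last first.
  by rewrite lerDr cdot_ge0.
rewrite mulr_suml cdotE; apply: ler_sum => i _.
have -> : (M *m x) i 0 = cdot ((row i M) ^t*) x.
  by rewrite /cdot trmxCK -row_mul [RHS]mxE.
by rewrite cdotC mulrC cdot_cauchy.
Qed.

(** Young's inequality: expand the squared norm of [x - d *: y] and divide by [d]. *)
Lemma re2_cdot_le n (d : C) (x y : 'cV[C]_n) : 0 < d ->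
  re2 (cdot x y) <= d^-1 * cdot x x + d * cdot y y.
Proof.
move=> d0; have := cdot_ge0 (x - d *: y).
have dr : d^* = d by rewrite conj_Creal // ger0_real ?ltW.
rewrite !(cdotBl, cdotBr, cdotZl, cdotZr) dr => h.
rewrite -subr_ge0 -(pmulr_rge0 _ d0) (le_trans h) // le_eqVlt; apply/orP; left.
apply/eqP; rewrite /re2 cdotC; field; exact: lt0r_neq0.
Qed.

(* The sign of a solution of the Lyapunov inequality of a triangular matrix is
   decided by taking Schur complements along the flag it preserves. *)
Lemma triangular_lyapunov_pos n (A X : 'M[C]_n) : X ^t* = X ->
  (forall i j : 'I_n, (j < i)%N -> A i j = 0) ->
  (forall i, A i i + (A i i)^* < 0) ->
  (forall x, x != 0 -> re2 (cdot (X *m x) (A *m x)) < 0) ->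
  forall x, x != 0 -> 0 < cdot x (X *m x).
Proof.
elim: n A X => [|n IH] A X hX hA hd hL x x0.
  by rewrite flatmx0 eqxx in x0.
move: A X hX hA hd hL x x0; rewrite -[n.+1]/(1 + n)%N => A X hX hA hd hL x x0.
(* The first basis vector is an eigenvector of the triangular [A], so the inequality at [e] fixes
   the sign of the pivot [x11]. *)
pose e : 'cV[C]_(1 + n) := col_mx 1%:M 0.
have e0 : e != 0.
  apply/eqP; rewrite /e -[RHS]col_mx0 => /eq_col_mx[/eqP].
  by rewrite (negPf (matrix_nonzero1 _ _)).
have hdl : dlsubmx A = 0.
  by apply/matrixP => i j; rewrite !mxE hA // ord1.
have hul : ulsubmx A = (A 0 0)%:M.
  by rewrite [LHS]mx11_scalar !mxE lshift0.
have Ae : A *m e = A 0 0 *: e.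
  rewrite -{1}[A]submxK hdl hul mul_block_col !mulmx0 mul0mx !addr0 mulmx1.
  by rewrite scale_col_mx scaler0 scalemx1.
pose x11 := cdot e (X *m e).
have x11_gt0 : 0 < x11.
  have := hL _ e0; rewrite Ae cdotZr cdotMl hX -/x11 /re2 rmorphM /=.
  rewrite [x11^*]cdot_herm // -mulrDl.
  by rewrite nmulr_rlt0 ?hd.
have Xul : ulsubmx X = x11%:M.
  rewrite /x11 -[X in cdot e (X *m e)]submxK mul_block_col !mulmx0 !addr0 !mulmx1.
  rewrite cdot_col cdot0l addr0 /cdot ctmx1 mul1mx.
  exact: mx11_scalar.
have Xdl : dlsubmx X = (ursubmx X)^t*.
  by rewrite -[X in dlsubmx X]hX -{1}[X]submxK ctmx_block block_mxKdl.
have Xdr : (drsubmx X) ^t* = drsubmx X.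
  rewrite -[X in _ = drsubmx X]hX -[X in _ = drsubmx (X ^t*)]submxK.
  by rewrite ctmx_block block_mxKdr.
(* The columns of [S] span the [X]-orthogonal complement of [e], and [X'] is the Schur complement.
   Modulo [e] the matrix [A] acts there as [drsubmx A], so the inequality restricts. *)
pose S : 'M[C]_(1 + n, n) := col_mx (- (x11^-1 *: ursubmx X)) 1%:M.
pose X' := drsubmx X - x11^-1 *: (dlsubmx X *m ursubmx X).
have XS : X *m S = col_mx 0 X'.
  rewrite -{1}[X]submxK mul_block_col Xul !mulmx1 !mulmxN mul_scalar_mx.
  rewrite scalerA divff ?lt0r_neq0 // scale1r addNr -scalemxAr.
  by rewrite /X' addrC.
have hx11 : x11^* = x11 by rewrite conj_Creal // ger0_real ?ltW.
have S_pos : forall y, y != 0 -> 0 < cdot y (X' *m y).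
  apply: (IH (drsubmx A)).
  - rewrite /X' ctmxB ctmxZ ctmxM rmorphV ?unitfE ?lt0r_neq0 //= hx11.
    by rewrite Xdr Xdl trmxCK.
  - by move=> i j ij; rewrite !mxE; apply: hA; rewrite ltn_add2l.
  - by move=> i; rewrite !mxE hd.
  move=> y y0.
  have : S *m y != 0.
    apply: contraNneq y0; rewrite /S mul_col_mx mul1mx -[RHS]col_mx0.
    by case/eq_col_mx => _ ->.
  have Ay : dsubmx (A *m (S *m y)) = drsubmx A *m y.
    rewrite /S mul_col_mx mul1mx -{1}[A]submxK hdl mul_block_col col_mxKd.
    by rewrite mul0mx add0r.
  move/hL; rewrite mulmxA XS mul_col_mx mul0mx -[A *m _]vsubmxK Ay cdot_col.
  by rewrite cdot0l add0r.
pose y := dsubmx x.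
pose s := x - S *m y.
have hs : s = (s 0 0) *: e.
  rewrite -{1}[s]vsubmxK scale_col_mx scaler0 scalemx1; congr col_mx.
    by rewrite [LHS]mx11_scalar !mxE lshift0.
  by rewrite /s linearB /= /S mul_col_mx mul1mx col_mxKd subrr.
have XSe z : cdot e (X *m (S *m z)) = 0.
  by rewrite mulmxA XS mul_col_mx mul0mx cdot_col cdot0l cdot0r addr0.
have hx : x = S *m y + s 0 0 *: e by rewrite -hs /s addrC subrK.
have -> : cdot x (X *m x) = cdot y (X' *m y) + x11 * (s 0 0 * (s 0 0)^*).
  rewrite hx mulmxDr !(cdotDl, cdotDr) -scalemxAr !(cdotZl, cdotZr) XSe.
  rewrite -[cdot (S *m y) (X *m e)]cdotC [cdot (X *m e) _]cdotMl hX XSe conjC0.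
  have -> : cdot (S *m y) (X *m (S *m y)) = cdot y (X' *m y).
    rewrite [X *m _]mulmxA XS !mul_col_mx mul0mx mul1mx cdot_col cdot0r.
    by rewrite add0r.
  by rewrite -/x11; ring.
have [y0|y0] := eqVneq y 0.
  rewrite y0 cdot0l add0r pmulr_rgt0 // mul_conjC_gt0.
  by apply: contraNneq x0 => s0; rewrite hx y0 s0 mulmx0 scale0r addr0.
by rewrite ltr_pwDl ?S_pos // mulr_ge0 ?mul_conjC_ge0 // ltW.
Qed.

End Bounds.

(** This is the Riccati equation with [R = 0] and [Q = 1%:M]. Its Hamiltonian is block triangular,
    so an imaginary eigenvector would yield one of [A]. *)
Lemma lyapunov_exists (C : numClosedFieldType) n (A : 'M[C]_n) :
  (forall l, 0 <= l + l^* -> A - l%:M \in unitmx) ->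
  exists2 Y : 'M[C]_n, Y ^t* = Y & A ^t* *m Y + Y *m A = - 1%:M.
Proof.
move=> hA; have [] := @riccati_exists C n A 0 1%:M.
- exact: ctmx0.
- exact: ctmx1.
- by move=> b _; rewrite mulmx0.
- by move=> l b hl _; apply: stable_left.
- move=> l v hl; rewrite -[v]hsubmxK.
  set a := lsubmx v; set c := rsubmx v.
  rewrite /hamiltonian mul_row_block scale_row_mx !mulmxN mulmx0 mulmx1 addr0.
  case/eq_row_mx => h1 h2.
  have a0 : a = 0.
    rewrite -[a]trmxCK (@stable_right _ _ A hA l^* (a ^t*)) ?ctmx0 //.
      by rewrite conjCK addrC hl.
    by rewrite -ctmxZ -h1 ctmxM trmxCK.
  have c0 : c = 0.
    apply: (@stable_left _ _ A hA (- l)).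
      by rewrite rmorphN /= -opprD hl oppr0.
    by rewrite scaleNr -h2 a0 oppr0 add0r opprK.
  by rewrite a0 c0 row_mx0.
move=> Y hY h; exists Y => //; apply/eqP; rewrite -addr_eq0 -[X in _ == X]h.
by rewrite mulmx0 mul0mx addr0.
Qed.

(** A small multiple of a Lyapunov solution [Y] is added to the solution of [kyp]: it gains a term
    in [x], and Young's inequality charges the cross term in [B] to [u]. *)
Lemma kyp_strict (C : numClosedFieldType) n m (A : 'M[C]_n) (B : 'M[C]_(n, m))
    (Ct : 'M[C]_(m, n)) (D : 'M[C]_m) (kappa : C) :
  (forall l, 0 <= l + l^* -> A - l%:M \in unitmx) ->
  (forall u, u != 0 -> 0 < re2 (cdot u (D *m u))) ->
  (forall l x u, l + l^* = 0 -> l *: x = A *m x + B *m u -> u != 0 ->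
     0 < re2 (cdot u (Ct *m x + D *m u))) ->
  0 < kappa ->
  exists2 X : 'M[C]_n, X ^t* = X & exists2 c, 0 < c &
    forall x u, re2 (cdot (X *m x) (A *m x + B *m u)
                     - cdot u (Ct *m x + D *m u))
                <= kappa * cdot u u - c * cdot x x.
Proof.
move=> hA hD hfreq k0.
have [X hX hX0] := kyp hA hD hfreq.
have [Y hY hY1] := lyapunov_exists hA.
have [k kgt0 hk] := mulmx_bounded (B ^t* *m Y).
have kappa_r : kappa^* = kappa by rewrite conj_Creal // ger0_real ?ltW.
have k_r : k^* = k by rewrite conj_Creal // ger0_real ?ltW.
(* With Young's constant [2 * k], half of the gain in [x] is lost and the cost in [u] is
   [eta * (2 * k)], that is [kappa]. *)
pose eta := kappa / (2 * k).
have eta0 : 0 < eta by rewrite divr_gt0 // mulr_gt0.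
have eta_r : eta^* = eta by rewrite conj_Creal // ger0_real ?ltW.
exists (X + eta *: Y).
  by rewrite ctmxD ctmxZ hX hY eta_r.
exists (eta / 2); first by rewrite divr_gt0.
move=> x u.
have hYA : re2 (cdot (Y *m x) (A *m x)) = - cdot x x.
  rewrite /re2 cdotC [cdot (A *m x) _]cdotMl [cdot (Y *m x) _]cdotMl hY !mulmxA.
  by rewrite -cdotDr -mulmxDl addrC hY1 mulNmx mul1mx cdotNr.
have hYB : re2 (cdot (Y *m x) (B *m u))
    <= (2 * k)^-1 * (k * cdot x x) + 2 * k * cdot u u.
  have -> : cdot (Y *m x) (B *m u) = cdot (B ^t* *m Y *m x) u.
    by rewrite -mulmxA [RHS]cdotMl trmxCK.
  have k2 : 0 < 2 * k by rewrite mulr_gt0.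
  apply: (le_trans (re2_cdot_le _ _ k2)); rewrite lerD2r ler_pM2l ?invr_gt0 //.
have -> : cdot ((X + eta *: Y) *m x) (A *m x + B *m u) - cdot u (Ct *m x + D *m u)
  = (cdot (X *m x) (A *m x + B *m u) - cdot u (Ct *m x + D *m u))
    + eta * (cdot (Y *m x) (A *m x) + cdot (Y *m x) (B *m u)).
  by rewrite mulmxDl cdotDl -scalemxAl cdotZl eta_r -cdotDr; ring.
rewrite re2D re2Zl // [re2 (cdot (Y *m x) _ + _)]re2D hYA.
apply: (le_trans (y := 0 + eta * (- cdot x x
  + ((2 * k)^-1 * (k * cdot x x) + 2 * k * cdot u u)))).
  by apply: lerD; [exact: hX0 | rewrite ler_pM2l // lerD2l].
rewrite le_eqVlt; apply/orP; left; apply/eqP; rewrite /eta.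
by field; rewrite lt0r_neq0.
Qed.

(** * Elimination of the algebraic constraint *)

Section Lift.
Context {C : numClosedFieldType} {q r m : nat}.
Variables (J : 'M[C]_q) (B1 : 'M[C]_(q, m)) (B2 : 'M[C]_(r, m)).
Variables (C1 : 'M[C]_(m, q)) (C2 : 'M[C]_(m, r)) (D : 'M[C]_m).
Variables (X1 : 'M[C]_q) (c t : C).
Hypothesis c_gt0 : 0 < c.
Hypothesis t_gt0 : 0 < t.
Hypothesis D_pos : forall u, u != 0 -> 0 < re2 (cdot u (D *m u)).
Hypothesis X1_diss : forall x u,
  re2 (cdot (X1 *m x) (J *m x + B1 *m u)
       - cdot u (C1 *m x + (D - C2 *m B2) *m u)) <= t * cdot u u - c * cdot x x.

(* The multiplier [psi = K x1 + L x2] of the algebraic constraint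
   [x2 + B2 u = 0] is [- Theta (x2 + B2 u0)], where [u0] maximizes the supply
   rate penalized by the [Theta]-norm of the constraint; [u0] then also maximizes
   the supply rate with the multiplier. *)
Lemma elimination : exists (K : 'M[C]_(r, q)) (L : 'M[C]_r),
  forall x1 x2 u, (x1 != 0) || (x2 != 0) ->
    re2 (cdot (X1 *m x1) (J *m x1 + B1 *m u)
         + cdot (K *m x1 + L *m x2) (x2 + B2 *m u)
         - cdot u (C1 *m x1 + C2 *m x2 + (D + t%:M) *m u)) < 0.
Proof.
have t_r : t^* = t by rewrite conj_Creal // ger0_real ?ltW.
(* The weight [2 / t] is Young's constant for the cross term between [w] and [C2 *m v], so that the
   [Theta]-norm of [v] absorbs that term with [cdot v v] to spare. *)
pose Theta : 'M[C]_r := 1%:M + (2 / t) *: (C2 ^t* *m C2).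
have hTheta : Theta ^t* = Theta.
  rewrite /Theta ctmxD ctmx1 ctmxZ ctmxM trmxCK rmorphM /= conjC_nat.
  by rewrite fmorphV /= t_r.
have Theta_form v :
    cdot v (Theta *m v) = cdot v v + 2 / t * cdot (C2 *m v) (C2 *m v).
  rewrite /Theta mulmxDl mul1mx cdotDr -scalemxAl cdotZr.
  by rewrite [cdot (C2 *m v) _]cdotMl mulmxA.
have tw : 0 < 2 / t by rewrite divr_gt0.
have Theta_ge0 v : 0 <= cdot v (Theta *m v).
  by rewrite Theta_form addr_ge0 ?cdot_ge0 // mulr_ge0 ?cdot_ge0 // ltW.
clearbody Theta.
pose W := (D + t%:M) + (D + t%:M) ^t*.
have W_herm : W ^t* = W by rewrite /W ctmxD trmxCK addrC.
have W_form u : cdot u (W *m u) = re2 (cdot u ((D + t%:M) *m u)).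
  by rewrite /re2 cdotC [cdot (_ *m u) u]cdotMl -cdotDr -mulmxDl.
have W_pos u : u != 0 -> 0 < cdot u (W *m u).
  move=> u0; rewrite W_form mulmxDl cdotDr re2D mul_scalar_mx cdotZr re2Zl //.
  by rewrite addr_gt0 ?D_pos // mulr_gt0 // re2_id ?cdotC // mulr_gt0 ?cdot_gt0.
have W_ge0 u : 0 <= cdot u (W *m u).
  by have [->|/W_pos/ltW//] := eqVneq u 0; rewrite cdot0l.
clearbody W.
(* Stationarity of the penalized supply rate is a linear equation in the input with matrix [H]; [G1]
   and [G2] express its solution [w] through [x1] and [x2]. *)
pose H := W + B2 ^t* *m Theta *m B2.
have H_unit : H \in unitmx.
  apply: posdef_unit => u u0; rewrite re2_id; last first.
    rewrite cdot_herm // /H ctmxD W_herm !ctmxM trmxCK hTheta.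
    by rewrite mulmxA.
  rewrite mulr_gt0 // /H mulmxDl cdotDr ltr_wpDr ?W_pos // -!mulmxA -cdotMl.
  exact: Theta_ge0.
pose G1 := invmx H *m (B1 ^t* *m X1 - C1).
pose G2 := - (invmx H *m (C2 + B2 ^t* *m Theta)).
exists (- (Theta *m B2 *m G1)), (- (Theta *m (1%:M + B2 *m G2))).
move=> x1 x2 u hx.
pose w := G1 *m x1 + G2 *m x2.
pose v := x2 + B2 *m w.
have -> : - (Theta *m B2 *m G1) *m x1 + - (Theta *m (1%:M + B2 *m G2)) *m x2
   = - (Theta *m v).
  rewrite /v /w; move: (G1) (G2) => g1 g2; rewrite !mulNmx -opprD; congr (- _).
  by rewrite !(mulmxDr, mulmxDl, mulmx1, mulmxA) addrCA.
have hw : W *m w = B1 ^t* *m X1 *m x1 - C1 *m x1 - C2 *m x2 - B2 ^t* *m (Theta *m v).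
  have : H *m w = (B1 ^t* *m X1 - C1) *m x1 - (C2 + B2 ^t* *m Theta) *m x2.
    by rewrite /w /G1 /G2 mulmxDr mulNmx mulmxN -!mulmxA !mulKVmx.
  move=> h; rewrite -[LHS](addrK (B2 ^t* *m Theta *m B2 *m w)) -mulmxDl h.
  rewrite /v; move: (w) => z; rewrite !(mulmxDr, mulmxDl, mulmxBl, mulmxA, opprD).
  by rewrite !mulNmx !addrA.
clearbody w.
pose f0 z := re2 (cdot (X1 *m x1) (J *m x1 + B1 *m z)
                  - cdot z (C1 *m x1 + C2 *m x2 + (D + t%:M) *m z)).
pose f z := f0 z - re2 (cdot (Theta *m v) (x2 + B2 *m z)).
suff : f u < 0.
  by rewrite /f /f0 -re2B cdotNl addrAC.
have hB1 z : re2 (cdot (X1 *m x1) (B1 *m z)) = re2 (cdot z (B1 ^t* *m X1 *m x1)).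
  by rewrite -re2_conj cdotC cdotMl mulmxA.
have hB2 z :
    re2 (cdot (Theta *m v) (B2 *m z)) = re2 (cdot z (B2 ^t* *m (Theta *m v))).
  by rewrite -re2_conj cdotC cdotMl.
have fE z : f z = re2 (cdot (X1 *m x1) (J *m x1) - cdot (Theta *m v) x2)
    + re2 (cdot z (W *m w)) - cdot z (W *m z).
  rewrite /f /f0 W_form hw !(cdotDr, cdotNr) !(re2D, re2N) hB1 hB2; ring.
(* By [hw], [w] is also stationary for the concave quadratic [f], so only the value at [w] has to be
   bounded. *)
have f_max : f u = f w - cdot (u - w) (W *m (u - w)).
  rewrite !fE mulmxBr !(cdotBl, cdotBr) /re2 !cdot_herm //; ring.
rewrite f_max (le_lt_trans (y := f w)) // ?gerBl ?W_ge0 //.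
(* Substituting [x2 = v - B2 *m w] produces the reduced feedthrough [D - C2 *m B2] and a cross term
   in [C2 *m v]. Of the margin [2 * t], [X1_diss] uses [t] and Young's inequality [t / 2]. *)
have f0_le : f0 w <= cdot v (Theta *m v) - cdot v v - c * cdot x1 x1
                     - t / 2 * cdot w w.
  have -> : f0 w = re2 (cdot (X1 *m x1) (J *m x1 + B1 *m w)
       - cdot w (C1 *m x1 + (D - C2 *m B2) *m w))
       + re2 (cdot w (- (C2 *m v))) - 2 * t * cdot w w.
    rewrite /f0 /v mulmxBl !mulmxDr mulmxDl mul_scalar_mx -!mulmxA.
    rewrite !(cdotDr, cdotNr) !(re2D, re2N) cdotZr re2Zl //.
    rewrite [re2 (cdot w w)]re2_id ?cdotC //.
    ring.
  rewrite Theta_form.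
  have := re2_cdot_le w (- (C2 *m v)) tw; have := X1_diss x1 w.
  rewrite cdotNl !cdotNr opprK => h1 h2.
  rewrite -subr_ge0 in h1; rewrite -subr_ge0 in h2; rewrite -subr_ge0.
  apply: (le_trans (addr_ge0 h1 h2)); rewrite le_eqVlt; apply/orP; left.
  by apply/eqP; field; rewrite lt0r_neq0.
have vv : re2 (cdot (Theta *m v) (x2 + B2 *m w)) = 2 * cdot v (Theta *m v).
  by rewrite -/v cdotMl hTheta re2_id // cdot_herm.
rewrite /f vv.
have pos : 0 < cdot v v + c * cdot x1 x1 + t / 2 * cdot w w.
  have t2 : 0 < t / 2 by rewrite divr_gt0.
  have h1 := cdot_ge0 v.
  have h2 : 0 <= c * cdot x1 x1 by rewrite mulr_ge0 ?cdot_ge0 // ltW.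
  have h3 : 0 <= t / 2 * cdot w w by rewrite mulr_ge0 ?cdot_ge0 // ltW.
  have [x10|x10] := eqVneq x1 0; last first.
    by rewrite ltr_wpDr // ltr_wpDl // mulr_gt0 // cdot_gt0.
  have [w0|w0] := eqVneq w 0; last first.
    by rewrite ltr_wpDl ?addr_ge0 // mulr_gt0 // cdot_gt0.
  rewrite ltr_wpDr // ltr_wpDr // cdot_gt0 /v w0 mulmx0 addr0.
  by move: hx; rewrite x10 eqxx.
rewrite subr_lt0 (le_lt_trans f0_le) // -subr_gt0.
apply: (lt_le_trans pos); rewrite -subr_ge0.
apply: (le_trans (Theta_ge0 v)); rewrite le_eqVlt; apply/orP; left.
by apply/eqP; ring.
Qed.

End Lift.

(** * Descriptor systems *)

(** In Weierstrass coordinates the multiplier is block lower triangular, since symmetry of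
    [E ^t* *m X] forces the upper right block to vanish; the lower blocks come from [elimination].
    At [u = 0] the inequality for [X1] is a Lyapunov inequality for the stable triangular [J], which
    makes [X1] positive. *)
Lemma descriptor_kyp (C : numClosedFieldType) q r m (W T : 'M[C]_(q + r))
    (J : 'M[C]_q) (B : 'M[C]_(q + r, m)) (Ct : 'M[C]_(m, q + r)) (D : 'M[C]_m)
    (t : C) :
  let E := W *m block_mx 1%:M 0 0 0 *m T in
  let A := W *m block_mx J 0 0 1%:M *m T in
  W \in unitmx -> T \in unitmx ->
  (forall i j : 'I_q, (j < i)%N -> J i j = 0) ->
  (forall l, 0 <= l + l^* -> J - l%:M \in unitmx) ->
  (forall u, u != 0 -> 0 < re2 (cdot u (D *m u))) ->
  (forall u, u != 0 -> 0 < re2 (cdot u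
     ((D - rsubmx (Ct *m invmx T) *m dsubmx (invmx W *m B)) *m u))) ->
  (forall l x u, l + l^* = 0 -> l *: (E *m x) = A *m x + B *m u -> u != 0 ->
     0 < re2 (cdot u (Ct *m x + D *m u))) ->
  0 < t ->
  exists X : 'M[C]_(q + r), [/\ (E ^t* *m X) ^t* = E ^t* *m X,
    forall x, 0 <= cdot (X *m x) (E *m x) &
    forall x u, x != 0 ->
      re2 (cdot (X *m x) (A *m x + B *m u)
           - cdot u (Ct *m x + (D + t%:M) *m u)) < 0].
Proof.
move=> E A hW hT Jtri Jst D_pos Dr_pos freq t0.
pose B1 := usubmx (invmx W *m B); pose B2 := dsubmx (invmx W *m B).
pose C1 := lsubmx (Ct *m invmx T); pose C2 := rsubmx (Ct *m invmx T).
have BE : B = W *m col_mx B1 B2 by rewrite vsubmxK mulKVmx.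
have CE : Ct = row_mx C1 C2 *m T by rewrite hsubmxK mulmxKV.
have freq1 l x u : l + l^* = 0 -> l *: x = J *m x + B1 *m u -> u != 0 ->
    0 < re2 (cdot u (C1 *m x + (D - C2 *m B2) *m u)).
  move=> hl hx u0.
  have := freq l (invmx T *m col_mx x (- (B2 *m u))) u hl _ u0.
  rewrite CE -!mulmxA mulKVmx // mul_row_col.
  have -> : C1 *m x + C2 *m - (B2 *m u) + D *m u = C1 *m x + (D - C2 *m B2) *m u.
    by rewrite mulmxBl mulmxN -!mulmxA -addrA [- _ + _]addrC.
  apply; rewrite /E /A BE -!mulmxA !mul_block_col mul_col_mx.
  rewrite !(mul1mx, mul0mx, mulmx0, addr0, add0r) -mulmxDr add_col_mx addNr.
  by rewrite scalemxAr scale_col_mx hx scaler0.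
have [X1 hX1 [c c0 hdiss]] := kyp_strict Jst Dr_pos freq1 t0.
have [K [L hKL]] := elimination c0 t0 D_pos hdiss.
pose Xh : 'M[C]_(q + r) := block_mx X1 0 K L.
have X1_pos x : x != 0 -> 0 < cdot x (X1 *m x).
  apply: (triangular_lyapunov_pos hX1 Jtri) => [i|y y0].
    rewrite real_ltNge ?real0 ?(re2_real (J i i)) //; apply/negP => /Jst; apply/negP.
    rewrite unitmxE -det_tr det_trig; last first.
      apply/is_trig_mxP => k l kl; rewrite !mxE (Jtri l k kl) sub0r.
      by rewrite -val_eqE /= gtn_eqF // mulr0n oppr0.
    rewrite (bigD1 i) //= !mxE eqxx mulr1n subrr mul0r unitr0.
    by [].
  have := hdiss y 0; rewrite !mulmx0 !addr0 !cdot0l subr0 mulr0 sub0r.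
  by move/le_lt_trans; apply; rewrite oppr_lt0 mulr_gt0 // cdot_gt0.
exists (invmx W ^t* *m Xh *m T).
have hEX : E ^t* *m (invmx W ^t* *m Xh *m T) = T ^t* *m block_mx X1 0 0 0 *m T.
  rewrite /E !ctmxM ctmx_block ctmx1 !ctmx0 !mulmxA.
  rewrite -[_ *m W ^t* *m _]mulmxA -ctmxM mulVmx // ctmx1 mulmx1.
  rewrite -[T ^t* *m _ *m Xh]mulmxA /Xh mulmx_block.
  by rewrite !(mul1mx, mul0mx, mulmx0, addr0, add0r).
split.
- by rewrite hEX !ctmxM trmxCK ctmx_block hX1 !ctmx0 !mulmxA.
- move=> x; rewrite -cdotC conjC_ge0 cdotMl mulmxA hEX -!mulmxA -cdotMl.
  rewrite -[T *m x]vsubmxK mul_block_col !mul0mx !addr0 cdot_col cdot0r addr0.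
  by have [->|/X1_pos/ltW//] := eqVneq (usubmx (T *m x)) 0; rewrite cdot0l.
move=> x u x0; set z := T *m x.
have z0 : z != 0.
  by apply: contraNneq x0 => hz; rewrite -[x](mulKmx hT) -/z hz mulmx0.
have hz : (usubmx z != 0) || (dsubmx z != 0).
  rewrite -negb_and; apply: contraNN z0 => /andP[/eqP h1 /eqP h2].
  by rewrite -[z]vsubmxK h1 h2 col_mx0.
have := hKL (usubmx z) (dsubmx z) u hz; congr (re2 (_ - _) < 0); last first.
  by rewrite {2}CE -mulmxA -/z -{3}[z]vsubmxK mul_row_col.
rewrite -cdot_col -mulmxA -/z -mulmxA [RHS]cdotMl trmxCK; congr cdot.
  by rewrite -{4}[z]vsubmxK /Xh mul_block_col mul0mx addr0.
rewrite /A BE -!mulmxA -/z -mulmxDr mulKmx // -{3}[z]vsubmxK mul_block_col.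
rewrite mulKmx // mul_col_mx !mul0mx mul1mx addr0 add0r add_col_mx.
by rewrite col_mxKd.
Qed.

(** * Real systems and port-Hamiltonian form *)

Section RealDot.
Local Open Scope complex_scope.
Local Open Scope ring_scope.
Context {R : realType}.

Definition rdot n (x y : 'cV[R]_n) : R := (x^T *m y) 0 0.

Lemma rdotE n (x y : 'cV[R]_n) : rdot x y = \sum_i x i 0 * y i 0.
Proof. by rewrite /rdot mxE; apply: eq_bigr => i _; rewrite !mxE. Qed.

Lemma rdotDl n (x y z : 'cV[R]_n) : rdot (x + y) z = rdot x z + rdot y z.
Proof. by rewrite /rdot linearD /= mulmxDl mxE. Qed.

Lemma rdotDr n (x y z : 'cV[R]_n) : rdot z (x + y) = rdot z x + rdot z y.
Proof. by rewrite /rdot mulmxDr mxE. Qed.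

Lemma rdotNl n (x y : 'cV[R]_n) : rdot (- x) y = - rdot x y.
Proof. by rewrite /rdot linearN /= mulNmx mxE. Qed.

Lemma rdotNr n (x y : 'cV[R]_n) : rdot x (- y) = - rdot x y.
Proof. by rewrite /rdot mulmxN mxE. Qed.

Lemma rdotZl n a (x y : 'cV[R]_n) : rdot (a *: x) y = a * rdot x y.
Proof. by rewrite /rdot linearZ /= -scalemxAl mxE. Qed.

Lemma rdotZr n a (x y : 'cV[R]_n) : rdot x (a *: y) = a * rdot x y.
Proof. by rewrite /rdot -scalemxAr mxE. Qed.

Lemma rdot0l n (x : 'cV[R]_n) : rdot 0 x = 0.
Proof. by rewrite /rdot trmx0 mul0mx mxE. Qed.

Lemma rdot0r n (x : 'cV[R]_n) : rdot x 0 = 0.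
Proof. by rewrite /rdot mulmx0 mxE. Qed.

Lemma rdotC n (x y : 'cV[R]_n) : rdot x y = rdot y x.
Proof. by rewrite !rdotE; apply: eq_bigr => i _; rewrite mulrC. Qed.

Lemma rdotMl m n (A : 'M[R]_(m, n)) x y :
  rdot (A *m x) y = rdot x (A^T *m y).
Proof. by rewrite /rdot trmx_mul mulmxA. Qed.

Lemma rdotMr m n (A : 'M[R]_(m, n)) x y :
  rdot x (A *m y) = rdot (A^T *m x) y.
Proof. by rewrite rdotMl trmxK. Qed.

Lemma rdot_ge0 n (x : 'cV[R]_n) : 0 <= rdot x x.
Proof. by rewrite rdotE sumr_ge0 // => i _; rewrite -expr2 sqr_ge0. Qed.

Lemma rdot_eq0 n (x : 'cV[R]_n) : (rdot x x == 0) = (x == 0).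
Proof.
apply/eqP/eqP => [|->]; last exact: rdot0r.
rewrite rdotE => /psumr_eq0P h; apply/matrixP => i j; rewrite ord1 mxE.
apply/eqP; rewrite -sqrf_eq0 expr2 h // => k _.
by rewrite -expr2 sqr_ge0.
Qed.

Lemma rdot_gt0 n (x : 'cV[R]_n) : (0 < rdot x x) = (x != 0).
Proof. by rewrite lt_def rdot_ge0 andbT rdot_eq0. Qed.

Lemma rdot_col m n (x y : 'cV[R]_m) (z t : 'cV[R]_n) :
  rdot (col_mx x z) (col_mx y t) = rdot x y + rdot z t.
Proof. by rewrite /rdot tr_col_mx mul_row_col mxE. Qed.

Lemma formE n (M : 'M[R]_n) (x : 'cV[R]_n) :
  (x^T *m M *m x) 0 0 = rdot x (M *m x).
Proof. by rewrite /rdot mulmxA. Qed.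

Lemma psdmxP n (M : 'M[R]_n) :
  psdmx M <-> M^T = M /\ forall x, 0 <= rdot x (M *m x).
Proof. by split=> -[h1 h2]; split=> // x; have := h2 x; rewrite formE. Qed.

Lemma pdmxP n (M : 'M[R]_n) :
  pdmx M <-> M^T = M /\ forall x, x != 0 -> 0 < rdot x (M *m x).
Proof. by split=> -[h1 h2]; split=> // x /h2; rewrite formE. Qed.

Lemma cplxmxM m n p (A : 'M[R]_(m, n)) (B : 'M[R]_(n, p)) :
  cplxmx (A *m B) = cplxmx A *m cplxmx B.
Proof. exact: map_mxM. Qed.

Lemma cplxmxD m n (A B : 'M[R]_(m, n)) : cplxmx (A + B) = cplxmx A + cplxmx B.
Proof. exact: map_mxD. Qed.

Lemma cplxmx_ct m n (A : 'M[R]_(m, n)) : (cplxmx A) ^t* = cplxmx A^T.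
Proof.
apply/matrixP => i j; rewrite !mxE.
by apply/CrealP; rewrite complex_real.
Qed.

Lemma cplxmx_eq0 m n (A : 'M[R]_(m, n)) : (cplxmx A == 0) = (A == 0).
Proof. exact: map_mx_eq0. Qed.

Definition remx m n (X : 'M[R[i]]_(m, n)) : 'M[R]_(m, n) :=
  map_mx (@complex.Re R) X.

Lemma remx_mulr m n p (X : 'M[R[i]]_(m, n)) (A : 'M[R]_(n, p)) :
  remx (X *m cplxmx A) = remx X *m A.
Proof.
apply/matrixP => i j; rewrite !mxE raddf_sum; apply: eq_bigr => k _.
by rewrite !mxE; case: (X i k) => a b /=; rewrite mulr0 subr0.
Qed.

Lemma remx_mull m n p (A : 'M[R]_(m, n)) (X : 'M[R[i]]_(n, p)) :
  remx (cplxmx A *m X) = A *m remx X.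
Proof.
apply/matrixP => i j; rewrite !mxE raddf_sum; apply: eq_bigr => k _.
by rewrite !mxE; case: (X k j) => a b /=; rewrite mul0r subr0.
Qed.

Lemma remx_ct m n (X : 'M[R[i]]_(m, n)) : remx (X ^t*) = (remx X)^T.
Proof. by apply/matrixP => i j; rewrite !mxE; case: (X j i). Qed.

Lemma re2_Re (z : R[i]) : re2 z = (2 * complex.Re z)%:C.
Proof.
case: z => a b; apply/eqP; rewrite /re2 eq_complex /= subrr eqxx andbT.
by rewrite mulr2n mulrDl mul1r.
Qed.

Lemma re2_cdot_cplx n (X : 'M[R[i]]_n) (x y : 'cV[R]_n) :
  re2 (cdot (X *m cplxmx x) (cplxmx y)) = (2 * rdot (remx X *m x) y)%:C.
Proof.
rewrite re2_Re /cdot; congr ((2 * _)%:C).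
transitivity (remx ((X *m cplxmx x) ^t* *m cplxmx y) 0 0); first by rewrite [RHS]mxE.
by rewrite remx_mulr remx_ct remx_mulr.
Qed.

Lemma cdot_cplx n (x y : 'cV[R]_n) :
  cdot (cplxmx x) (cplxmx y) = (rdot x y)%:C.
Proof. by rewrite /cdot cplxmx_ct -cplxmxM mxE. Qed.

(** Strictness at [u = 0] makes [X] injective. In the variable [y = X *m x] the skew and symmetric
    parts of [A *m invmx X] are J and -R, while F and P are the half sum and half difference of [K]
    and [B]. The form of the dissipation block at [(y, u)] is then minus the left side of the
    inequality. *)
Lemma dissipative_PHbar n m (E A X : 'M[R]_n) (B : 'M[R]_(n, m))
    (Ct : 'M[R]_(m, n)) (D : 'M[R]_m) :
  psdmx (E^T *m X) ->
  (forall x u, x != 0 ->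
     rdot (X *m x) (A *m x + B *m u) - rdot u (Ct *m x + D *m u) < 0) ->
  (forall u, 0 <= rdot u (D *m u)) ->
  S_PHbar (System E A B Ct D).
Proof.
move=> hE hX hD.
have Xu : X \in unitmx.
  rewrite -unitmx_tr -row_free_unit -kermx_eq0.
  apply/rowV0P => v /sub_kermxP hv; apply/eqP/negPn/negP => v0.
  have vT0 : v^T != 0 by apply: contraNneq v0 => h; rewrite -[v]trmxK h trmx0.
  have := hX _ 0 vT0; rewrite -[X *m _]trmxK trmx_mul trmxK hv trmx0 !rdot0l.
  by rewrite subrr ltxx.
pose G := A *m invmx X; pose K := (invmx X)^T *m Ct^T.
pose h : R := 2^-1.
exists E, (h *: (G - G^T)), (- (h *: (G + G^T))), X.
exists (h *: (K + B)), (h *: (K - B)), (h *: (D + D^T)), (h *: (D - D^T)).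
have half k l (M N : 'M[R]_(k, l)) : h *: (M + N) + h *: (M - N) = M.
  rewrite -scalerDr addrACA subrr addr0 -mulr2n -scaler_nat scalerA.
  by rewrite mulVf ?scale1r ?pnatr_eq0.
have half' k l (M N : 'M[R]_(k, l)) : h *: (M + N) - h *: (M - N) = N.
  by rewrite -scalerN opprB [M + N]addrC half.
split.
- by rewrite linearZ /= linearB /= trmxK -scalerN opprB.
- by rewrite linearZ /= linearB /= trmxK -scalerN opprB.
- exact: hE.
- apply/psdmxP; split.
    have sym k (M : 'M[R]_k) : (M + M^T)^T = M + M^T.
      by rewrite linearD /= trmxK addrC.
    rewrite tr_block_mx trmxK linearN /= [(h *: (G + G^T))^T]linearZ /= sym.
    by rewrite [(h *: (D + D^T))^T]linearZ /= sym.
  move=> z; rewrite -[z]vsubmxK; set y := usubmx z; set u := dsubmx z.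
  rewrite mul_block_col rdot_col !rdotDr.
  pose x := invmx X *m y.
  have -> : rdot y (- (h *: (G + G^T)) *m y) + rdot y (h *: (K - B) *m u)
     + (rdot u ((h *: (K - B))^T *m y) + rdot u (h *: (D + D^T) *m u))
     = - (rdot (X *m x) (A *m x + B *m u) - rdot u (Ct *m x + D *m u)).
    rewrite -[rdot u (_^T *m y)]rdotMl [rdot (_ *m u) y]rdotC.
    have -> : X *m x = y by rewrite mulKVmx.
    have -> : A *m x = G *m y by rewrite mulmxA.
    have -> : Ct *m x = K^T *m y by rewrite trmx_mul !trmxK mulmxA.
    rewrite !(mulmxDl, mulNmx, =^~ scalemxAl, rdotDr, rdotNr, rdotZr).
    rewrite -[rdot y (G^T *m y)]rdotMl [rdot (G *m y) y]rdotC.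
    rewrite -[rdot u (D^T *m u)]rdotMl [rdot (D *m u) u]rdotC.
    rewrite -[rdot u (K^T *m y)]rdotMl [rdot (K *m u) y]rdotC /h; lra.
  rewrite oppr_ge0; have [x0|x0] := eqVneq x 0; last exact/ltW/hX.
  by rewrite x0 !mulmx0 rdot0l !add0r oppr_le0.
- congr System.
  + by rewrite opprK addrC half mulmxKV.
  + by rewrite half'.
  + by rewrite half trmx_mul !trmxK mulmxKV.
  + by rewrite half.
Qed.

End RealDot.

(** * Evaluation of the transfer function *)

Local Notation "p %:F" := (@FracField.tofrac _ p).

Lemma frac_repr (K : idomainType) (g : {fraction K}) :
  (\n_(repr g))%:F = g * (\d_(repr g))%:F.
Proof.
rewrite -[X in X * _]reprK; unlock FracField.tofrac; rewrite -[RHS]FracField.pi_mul.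
apply/eqmodP; rewrite /= FracField.equivfE /FracField.mulf /=.
have d0 := denom_ratioP (repr g).
by rewrite !numden_Ratio ?mulf_neq0 ?mulr1 ?mul1r ?oner_eq0 //=.
Qed.

Section Evaluation.
Local Open Scope complex_scope.
Local Open Scope ring_scope.
Context {R : realType}.
Implicit Types (g : {fraction {poly R[i]}}) (s : R[i]).

(** The fraction [p / q] need not be in lowest terms: a zero of [rat_den g] at [s] would also be one
    of [rat_num g], because [q] does not vanish there, and this contradicts coprimality. *)
Lemma rat_evalE g (p q : {poly R[i]}) s : q.[s] != 0 -> g * q%:F = p%:F ->
  ~~ root (rat_den g) s /\ rat_eval g s = p.[s] / q.[s].
Proof.
move=> qs0 hg.
have d0 := denom_ratioP (repr g).
set d := gcdp \n_(repr g) \d_(repr g).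
have dn0 : d != 0 by rewrite gcdp_eq0 negb_and d0 orbT.
have hn : rat_num g * d = \n_(repr g) by rewrite divpK ?dvdp_gcdl.
have hd : rat_den g * d = \d_(repr g) by rewrite divpK ?dvdp_gcdr.
have hpq : rat_num g * q = p * rat_den g.
  apply: (mulIf dn0); rewrite mulrAC hn -mulrA hd.
  apply/eqP; rewrite -tofrac_eq !tofracM frac_repr -hg mulrAC.
  by [].
have hpqs : (rat_num g).[s] * q.[s] = p.[s] * (rat_den g).[s].
  by rewrite -!hornerM hpq.
have den0 : ~~ root (rat_den g) s.
  apply/negP => hr; move: hpqs; rewrite (eqP hr) mulr0 => /eqP.
  rewrite mulf_eq0 (negPf qs0) orbF => hn0.
  have : coprimep (rat_num g) (rat_den g) by rewrite coprimep_div_gcd // d0 orbT.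
  by move/coprimep_root => /(_ _ hn0); rewrite (eqP hr) eqxx.
split=> //; rewrite /rat_eval; apply/eqP; rewrite eqr_div //.
by rewrite hpqs.
Qed.

(** Cramer's rule: multiplying by the determinant of the pencil turns the transfer function into a
    polynomial matrix [N], to which [rat_evalE] applies entrywise. *)
Lemma transfer_functionE n m (sys : system R n m) s :
  let E := cplxmx (sysE sys) in let A := cplxmx (sysA sys) in
  let B := cplxmx (sysB sys) in let Ct := cplxmx (sysC sys) in
  let D := cplxmx (sysD sys) in
  \det (s *: E - A) != 0 ->
  ~ mx_pole (transfer_function sys) s /\
  mx_eval (transfer_function sys) s = Ct *m invmx (s *: E - A) *m B + D.
Proof.
move=> E A B Ct D hdet.
pose P : 'M[{poly R[i]}]_n := 'X *: map_mx polyC E - map_mx polyC A.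
have P_eval : map_mx (horner_eval s) P = s *: E - A.
  by apply/matrixP => i j; rewrite !mxE /horner_eval !hornerE.
have detP : (\det P).[s] = \det (s *: E - A).
  by rewrite -P_eval det_map_mx.
pose N := map_mx polyC Ct *m \adj P *m map_mx polyC B + \det P *: map_mx polyC D.
have N_eval i j : (N i j).[s] = (\det (s *: E - A) *:
     (Ct *m invmx (s *: E - A) *m B + D)) i j.
  have -> : (N i j).[s] = map_mx (horner_eval s) N i j by rewrite [RHS]mxE.
  rewrite map_mxD !map_mxM map_mx_adj P_eval map_mxZ /= /horner_eval detP.
  have ev k l (M : 'M[R[i]]_(k, l)) : map_mx (horner_eval s) (map_mx polyC M) = M.
    by apply/matrixP => ? ?; rewrite !mxE /horner_eval hornerC.
  rewrite !ev scalerDr /invmx unitmxE unitfE hdet.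
  by rewrite -scalemxAr -scalemxAl scalerA divff // scale1r.
have GE i j : transfer_function sys i j * (\det P)%:F = (N i j)%:F.
  pose F k l (M : 'M[{poly R[i]}]_(k, l)) := map_mx (@FracField.tofrac _) M.
  have -> : transfer_function sys i j * (\det P)%:F
      = ((\det P)%:F *: transfer_function sys) i j by rewrite [RHS]mxE mulrC.
  have -> : (N i j)%:F = F _ _ N i j by rewrite [RHS]mxE.
  have cE k l (M : 'M[R]_(k, l)) : const_fracmx M = F _ _ (map_mx polyC (cplxmx M)).
    by apply/matrixP => ? ?; rewrite !mxE.
  congr (fun_of_matrix _ i j); rewrite /transfer_function !cE.
  have -> : 'X%:F *: F _ _ (map_mx polyC (cplxmx (sysE sys)))
      - F _ _ (map_mx polyC (cplxmx (sysA sys))) = F _ _ P.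
    by rewrite /F /P map_mxB map_mxZ.
  have dP0 : (\det P)%:F != 0.
    by rewrite tofrac_eq0; apply: contraNneq hdet => h; rewrite -detP h horner0.
  clearbody P; rewrite scalerDr /N /F map_mxD !map_mxM map_mxZ map_mx_adj /=.
  rewrite /invmx unitmxE unitfE det_map_mx dP0 -scalemxAr -scalemxAl scalerA.
  by rewrite divff // scale1r.
have ent i j := fun h => @rat_evalE _ _ _ s h (GE i j).
have hP : (\det P).[s] != 0 by rewrite detP.
split; first by case=> i [j]; apply/negP; case: (ent i j hP).
apply/matrixP => i j; rewrite mxE; have [_ ->] := ent i j hP.
by rewrite detP N_eval mxE mulrAC divff // mul1r.
Qed.

End Evaluation.

(** * Limits along the imaginary axis *)

Section Limits.
Local Open Scope complex_scope.
Local Open Scope ring_scope.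
Context {R : realType}.
Let K := cplx_num R.

Lemma cvg_mx_entries m n (f : R -> 'M[K]_(m, n)) (M : 'M[K]_(m, n)) :
  (forall i j, f w i j @[w --> +oo%R] --> M i j) -> f w @[w --> +oo%R] --> M.
Proof.
move=> h A [P hP hA].
have : \forall w \near +oo%R, forall i j, P i j (f w i j).
  by apply: filter_forall => i; apply: filter_forall => j; exact: (h i j _ (hP i j)).
by apply: filterS => w hw; apply: hA.
Qed.

Lemma cvg_mx_unique m n (f : R -> 'M[K]_(m, n)) (M N : 'M[K]_(m, n)) :
  f w @[w --> +oo%R] --> M -> f w @[w --> +oo%R] --> N -> M = N.
Proof.
move=> hM hN; apply/matrixP => i j.
have c (L : 'M[K]_(m, n)) : f w @[w --> +oo%R] --> L ->
    f w i j @[w --> +oo%R] --> L i j.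
  by move=> hL; apply: (@cvg_comp _ _ _ f (fun L : 'M[K]_(m, n) => L i j) _ _ _ hL);
    exact: coord_continuous.
exact: (cvg_unique (@norm_hausdorff K K^o) (c _ hM) (c _ hN)).
Qed.

Lemma cvg_horner (p : {poly K}) (f : R -> K) (a : K) :
  f w @[w --> +oo%R] --> a -> p.[f w] @[w --> +oo%R] --> p.[a].
Proof.
move=> hf; elim/poly_ind: p => [|p c IH].
  under eq_fun do rewrite horner0; rewrite horner0; exact: cvg_cst.
under eq_fun do rewrite hornerMXaddC; rewrite hornerMXaddC.
apply: (@cvgD K K^o R +oo%R _ (fun w => p.[f w] * f w) (fun=> c)).
  exact: (@cvgM K R +oo%R _ (fun w => p.[f w]) f _ _ IH hf).
exact: cvg_cst.
Qed.

Lemma cvg_inv_imag : ((0 +i* w)^-1 : K) @[w --> +oo%R] --> (0 : K).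
Proof.
apply/(@cvgrPdist_lt K K^o) => e e0.
have er : e = (complex.Re e)%:C by rewrite RRe_real // gtr0_real.
have e0' : 0 < complex.Re e by move: e0; rewrite er ltcR.
near=> w.
have w0 : 0 < w by near: w; apply: nbhs_pinfty_gt; rewrite num_real.
have hw : (complex.Re e)^-1 < w.
  by near: w; apply: nbhs_pinfty_gt; rewrite num_real.
rewrite sub0r normrN normrV; last first.
  by rewrite unitfE eq_complex /= negb_and (gt_eqF w0) orbT.
rewrite normc_def /= expr0n /= add0r sqrtr_sqr gtr0_norm // er.
rewrite -fmorphV ltcR invf_plt ?posrE //.
Unshelve. all: by end_near. Qed.

(** In the variable [z], the inverse of [0 +i* w], the function is rational with denominator
    [\det (E - z *: A)], nonzero at [z = 0] because [E] is invertible. The factor [z] in the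
    numerator leaves only [D]. *)
Lemma transfer_cvg n m (E A : 'M[R[i]]_n) (B : 'M[R[i]]_(n, m))
    (Ct : 'M[R[i]]_(m, n)) (D : 'M[R[i]]_m) :
  E \in unitmx ->
  (forall w : R, 0 <= w -> (0 +i* w) *: E - A \in unitmx) ->
  (Ct *m invmx ((0 +i* w) *: E - A) *m B + D : 'M[K]_m) @[w --> +oo%R]
    --> (D : 'M[K]_m).
Proof.
move=> hE hA.
pose P : 'M[{poly R[i]}]_n := map_mx polyC E - 'X *: map_mx polyC A.
have PE z : map_mx (horner_eval z) P = E - z *: A.
  by apply/matrixP => i j; rewrite !mxE /horner_eval !hornerE.
pose N := map_mx polyC Ct *m ('X *: \adj P) *m map_mx polyC B.
apply: cvg_mx_entries => i j.
have NE z : (N i j).[z] = z * (Ct *m \adj (E - z *: A) *m B) i j.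
  have -> : (N i j).[z] = map_mx (horner_eval z) N i j by rewrite [RHS]mxE.
  have ev k l (M : 'M[R[i]]_(k, l)) : map_mx (horner_eval z) (map_mx polyC M) = M.
    by apply/matrixP => ? ?; rewrite !mxE /horner_eval hornerC.
  rewrite /N !map_mxM map_mxZ map_mx_adj PE !ev /= /horner_eval hornerX.
  by rewrite -scalemxAr -scalemxAl mxE.
have dE z : (\det P).[z] = \det (E - z *: A) by rewrite -PE det_map_mx.
suff h : (N i j).[(0 +i* w)^-1] / (\det P).[(0 +i* w)^-1] + D i j
    @[w --> +oo%R] --> ((N i j).[0] / (\det P).[0] + D i j : K).
  have -> : D i j = (N i j).[0] / (\det P).[0] + D i j.
    by rewrite NE mul0r mul0r add0r.
  apply: cvg_trans h; apply: near_eq_cvg; near=> w.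
  have w0 : 0 < w by near: w; apply: nbhs_pinfty_gt; rewrite num_real.
  set z : R[i] := 0 +i* w.
  have z0 : z != 0 by rewrite eq_complex /= negb_and (gt_eqF w0) orbT.
  rewrite NE dE [in RHS]mxE; congr (_ + _).
  have hz : z *: E - A = z *: (E - z^-1 *: A).
    by rewrite scalerBr scalerA divff // scale1r.
  have u : E - z^-1 *: A \in unitmx.
    by have := hA _ (ltW w0); rewrite -/z hz unitmxZ // unitfE.
  rewrite hz invmxZ; last by rewrite unitmxZ // unitfE.
  rewrite /invmx u -scalemxAr -scalemxAl -scalemxAr -scalemxAl scalerA [in RHS]mxE.
  by rewrite mulrAC.
pose g (p : {poly K}) (w : R) : K := p.[(0 +i* w)^-1].
apply: (@cvgD K K^o R +oo%R _ (fun w => g (N i j) w * (g (\det P) w)^-1)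
  (fun=> D i j)); last exact: cvg_cst.
apply: cvgM; first exact: cvg_horner cvg_inv_imag.
apply: cvgV; last exact: cvg_horner cvg_inv_imag.
by rewrite dE scale0r subr0 -unitfE -unitmxE.
Unshelve. all: by end_near. Qed.

End Limits.

(** * ESPR systems are limits of port-Hamiltonian systems *)

Section Necessity.
Local Open Scope complex_scope.
Local Open Scope ring_scope.
Context {R : realType}.

Definition immx m n (X : 'M[R[i]]_(m, n)) : 'M[R]_(m, n) :=
  map_mx (@complex.Im R) X.

Lemma cplxmx_rect m n (X : 'M[R[i]]_(m, n)) :
  X = cplxmx (remx X) + (0 +i* 1) *: cplxmx (immx X).
Proof.
apply/matrixP => i j; rewrite !mxE; case: (X i j) => a b /=; apply/eqP.
rewrite eq_complex /=.
by apply/andP; split; apply/eqP; ring.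
Qed.

Lemma cdot_sym_cplx n (W : 'M[R]_n) (u : 'cV[R[i]]_n) : W^T = W ->
  cdot u (cplxmx W *m u)
  = (rdot (remx u) (W *m remx u) + rdot (immx u) (W *m immx u))%:C.
Proof.
move=> hW; rewrite {1 2}(cplxmx_rect u) mulmxDr -scalemxAr -!cplxmxM.
rewrite !(cdotDl, cdotDr, cdotZl, cdotZr) !cdot_cplx.
rewrite [rdot (immx u) (W *m remx u)]rdotMr hW [rdot (W *m _) _]rdotC.
move: (rdot _ _) (rdot _ _) (rdot _ _) => a b c; apply/eqP.
rewrite eq_complex /=; apply/andP; split; apply/eqP; ring.
Qed.

Lemma cplx_pos n (M : 'M[R]_n) (u : 'cV[R[i]]_n) : pdmx (M + M^T) -> u != 0 ->
  0 < re2 (cdot u (cplxmx M *m u)).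
Proof.
move=> /pdmxP[hs hM] u0.
have -> : re2 (cdot u (cplxmx M *m u)) = cdot u (cplxmx (M + M^T) *m u).
  by rewrite /re2 cdotC [cdot (_ *m u) u]cdotMl cplxmx_ct -cdotDr -mulmxDl cplxmxD.
rewrite cdot_sym_cplx // ltcR.
have ge0 x : 0 <= rdot x ((M + M^T) *m x).
  by have [->|/hM/ltW//] := eqVneq x 0; rewrite rdot0l.
have [h|h] := eqVneq (remx u) 0; last by rewrite ltr_wpDr // hM.
have [h'|h'] := eqVneq (immx u) 0; last by rewrite ltr_wpDl // hM.
move: u0; rewrite (cplxmx_rect u) h h' /cplxmx !map_mx0 scaler0 addr0.
by rewrite eqxx.
Qed.

Lemma conjmx_cplx m n (M : 'M[R]_(m, n)) : map_mx Num.conj (cplxmx M) = cplxmx M.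
Proof.
by apply/matrixP => i j; rewrite !mxE; apply/CrealP; rewrite complex_real.
Qed.

Lemma addJ_ge0 (l : R[i]) : (0 <= l + l^*) = (0 <= complex.Re l).
Proof. by have := re2_Re l; rewrite /re2 => ->; rewrite lecR pmulr_rge0. Qed.

Lemma addJ_eq0 (l : R[i]) : l + l^* = 0 -> l = 0 +i* complex.Im l.
Proof.
have := re2_Re l; rewrite /re2 => -> /(congr1 (@complex.Re R)) /= /eqP.
by case: l => a b /=; rewrite mulf_eq0 pnatr_eq0 /= => /eqP ->.
Qed.

Lemma hpdmx_add_ctr n (G : 'M[R[i]]_n) :
  hpdmx (add_ctr G) -> forall u, u != 0 -> 0 < re2 (cdot u (G *m u)).
Proof.
move=> [_ h] u /h; congr (_ < _).
by rewrite /re2 cdotC [cdot (G *m u) u]cdotMl -cdotDr -mulmxDl /cdot mulmxA.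
Qed.

Lemma S_e_PHbar n m (sys : system R n m) (t : R) : 0 < t -> S_e sys ->
  S_PHbar (System (sysE sys) (sysA sys) (sysB sys) (sysC sys)
                  (sysD sys + t%:M)).
Proof.
move=> t0 [] [_ [k [q [r [eqn [W [T [J0 [N0]]]]]]]]].
move=> [] [hW hT hJ [_ _] [hE hA]] hk hk1 heig hespr hD.
(* Degree 1 says this directly, degree 0 says that the identity of the block vanishes, and for
   [q = n] the block is empty. *)
have N00 : N0 = 0.
  move: hk; case: ifP => [_ [hN _]|hq _]; last first.
    have r0 : r = 0%N by move: hq; rewrite -eqn; lia.
    by move: N0 {hE}; rewrite r0 => N0; rewrite flatmx0.
  case: k hN hk1 => [|[|//]] hN _; last by rewrite expr1 in hN.
  by rewrite -[N0]mulr1 -[X in _ * X](expr0 N0) hN mulr0.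
rewrite N00 in hE => {N0 N00 hk hk1 k}.
move: sys W T hW hT hE hA heig hespr hD; case: n / eqn.
case=> E A B Ct D W T hW hT; rewrite /= !castmx_id => hE hA heig.
move=> [[_ _ hfreq] [Ginf hcvg hGinf]] hD.
have reg s : 0 <= complex.Re s -> \det (s *: cplxmx E - cplxmx A) != 0.
  by move=> hs; apply/eqP => /heig; rewrite ltNge hs.
have geval s : 0 <= complex.Re s ->
    mx_eval (transfer_function (System E A B Ct D)) s
    = cplxmx Ct *m invmx (s *: cplxmx E - cplxmx A) *m cplxmx B + cplxmx D.
  move=> /reg hs.
  by have [_ ->] := @transfer_functionE _ _ _ (System E A B Ct D) s hs.
have Jtri (i j : 'I_q) : (j < i)%N -> J0 i j = 0.
  move=> ji; have [_ h] := hJ i j; apply: h; first by move=> h; rewrite h ltnn in ji.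
  by move=> h; rewrite h ltnNge leqW in ji.
have pencilE l : l *: cplxmx E - cplxmx A
    = W *m block_mx (l%:M - J0) 0 0 (- 1%:M) *m T.
  rewrite hE hA scalemxAl scalemxAr -mulmxBl -mulmxBr; congr (_ *m _ *m _).
  rewrite scale_block_mx opp_block_mx add_block_mx !scaler0 !subr0 sub0r.
  by rewrite scalemx1.
have Jreg l : 0 <= l + l^* -> l%:M - J0 \in unitmx.
  rewrite addJ_ge0 => /reg; rewrite pencilE !det_mulmx det_ublock !mulf_eq0.
  by rewrite !negb_or unitmxE unitfE => /andP[/andP[_ /andP[]]].
have Jst l : 0 <= l + l^* -> J0 - l%:M \in unitmx.
  move=> /Jreg h; rewrite -opprB -scaleN1r unitmxZ // unitrN unitr1.
  by [].
have Dpos u : u != 0 -> 0 < re2 (cdot u (cplxmx D *m u)) by exact: cplx_pos.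
pose C1 := lsubmx (cplxmx Ct *m invmx T); pose C2 := rsubmx (cplxmx Ct *m invmx T).
pose B1 := usubmx (invmx W *m cplxmx B); pose B2 := dsubmx (invmx W *m cplxmx B).
pose Dr := cplxmx D - C2 *m B2.
have GE w : 0 <= w -> mx_eval (transfer_function (System E A B Ct D)) (0 +i* w)
    = C1 *m invmx ((0 +i* w) *: 1%:M - J0) *m B1 + Dr.
  move=> w0; rewrite geval // pencilE.
  set l : R[i] := 0 +i* w.
  have hl : l%:M - J0 \in unitmx.
    by apply: Jreg; rewrite addJ_ge0.
  have -> : invmx (W *m block_mx (l%:M - J0) 0 0 (- 1%:M) *m T) =
      invmx T *m block_mx (invmx (l%:M - J0)) 0 0 (- 1%:M) *m invmx W.
    set L := _ *m T; set V := _ *m invmx W.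
    have LV : L *m V = 1%:M.
      rewrite /L /V !mulmxA mulmxK // -[W *m _ *m block_mx _ _ _ _]mulmxA.
      rewrite mulmx_block !(mulmx0, mul0mx, addr0, add0r) mulmxV // mulNmx.
      by rewrite mulmxN mulmx1 opprK -scalar_mx_block mulmx1 mulmxV.
    by rewrite -[LHS]mulmx1 -LV mulKmx //; case/mulmx1_unit: LV.
  rewrite !mulmxA -[cplxmx Ct *m invmx T]hsubmxK -/C1 -/C2 mul_row_block.
  rewrite -mulmxA -[invmx W *m _]vsubmxK -/B1 -/B2 mul_row_col.
  rewrite !(mulmx0, add0r, addr0) mulmxN mulmx1 mulNmx scalemx1 /Dr.
  by rewrite -addrA [- _ + _]addrC.
(* By [GE] the transfer function is a strictly proper part plus [Dr]; uniqueness of limits transfers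
   the positivity at infinity to [Dr]. *)
have DrE : Ginf = Dr.
  apply: (cvg_mx_unique hcvg).
  have : (C1 *m invmx ((0 +i* w) *: 1%:M - J0) *m B1 + Dr : 'M[cplx_num R]_m)
      @[w --> +oo%R] --> (Dr : 'M[cplx_num R]_m).
    apply: transfer_cvg; first exact: unitmx1.
    by move=> w w0; rewrite scalemx1; apply: Jreg; rewrite addJ_ge0.
  apply: cvg_trans; apply: near_eq_cvg; near=> w.
  by rewrite GE //; near: w; apply: nbhs_pinfty_ge; rewrite num_real.
rewrite DrE in hGinf.
have freq l (x : 'cV_(q + r)) (u : 'cV_m) : l + l^* = 0 ->
    l *: (cplxmx E *m x) = cplxmx A *m x + cplxmx B *m u -> u != 0 ->
    0 < re2 (cdot u (cplxmx Ct *m x + cplxmx D *m u)).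
  have main w y (v : 'cV_m) : 0 <= w ->
      (0 +i* w) *: (cplxmx E *m y) = cplxmx A *m y + cplxmx B *m v -> v != 0 ->
      0 < re2 (cdot v (cplxmx Ct *m y + cplxmx D *m v)).
    move=> w0 hy v0.
    have hG := hfreq w w0.
    rewrite geval // in hG.
    have := hpdmx_add_ctr hG v0.
    have hu : (0 +i* w) *: cplxmx E - cplxmx A \in unitmx.
      by rewrite unitmxE unitfE reg.
    have -> : cplxmx Ct *m y + cplxmx D *m v =
      (cplxmx Ct *m invmx ((0 +i* w) *: cplxmx E - cplxmx A) *m cplxmx B
       + cplxmx D) *m v; last by [].
    rewrite mulmxDl -!mulmxA; congr (_ *m _ + _).
    rewrite -[y in LHS](mulKmx hu) mulmxBl -scalemxAl hy.
    by rewrite addrAC subrr add0r.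
  (* Strict positive realness speaks of [0 <= w] only; since the system is real, conjugating the
     trajectory covers the negative frequencies. *)
  move=> /addJ_eq0; set w := complex.Im l => ->.
  have [w0|w0] := leP 0 w; first exact: main.
  move=> hx u0; rewrite -re2_conj.
  pose cj k (M : 'cV[R[i]]_k) := map_mx Num.conj M.
  have cjM k1 k2 (M : 'M[R]_(k1, k2)) v : cj _ (cplxmx M *m v) = cplxmx M *m cj _ v.
    by rewrite /cj map_mxM conjmx_cplx.
  have cdot_cj k (a b : 'cV[R[i]]_k) : (cdot a b)^* = cdot (cj _ a) (cj _ b).
    rewrite !cdotE rmorph_sum; apply: eq_bigr => i _.
    by rewrite rmorphM !mxE.
  have cjD k (a b : 'cV[R[i]]_k) : cj _ (a + b) = cj _ a + cj _ b.
    by rewrite /cj map_mxD.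
  rewrite cdot_cj cjD !cjM; apply: (main (- w)).
  - by rewrite oppr_ge0 ltW.
  - rewrite -!cjM -cjD -hx /cj map_mxZ; congr (_ *: _).
  - by rewrite map_mx_eq0.
have tc : 0 < t%:C :> R[i] by rewrite ltcR.
move: (freq); rewrite {1}hE {1}hA => freq'.
have [X [X1 X2 X3]] :=
  descriptor_kyp hW hT Jtri Jst Dpos (hpdmx_add_ctr hGinf) freq' tc.
rewrite -hE -hA in X1 X2 X3.
(* On real vectors the real part of a form in [X] only sees [remx X], so the three properties of [X]
   pass to it. *)
have hEX : remx ((cplxmx E)^t* *m X) = E^T *m remx X.
  by rewrite cplxmx_ct remx_mull.
apply: (@dissipative_PHbar _ _ _ E A (remx X)).
- apply/psdmxP; split; first by rewrite -hEX -remx_ct X1.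
  move=> x; rewrite -mulmxA rdotMr trmxK rdotC.
  have := X2 (cplxmx x); rewrite -cplxmxM => h.
  have : 0 <= re2 (cdot (X *m cplxmx x) (cplxmx (E *m x))).
    by rewrite /re2 addr_ge0 // conjC_ge0.
  by rewrite re2_cdot_cplx lecR pmulr_rge0.
- move=> x u x0.
  have := X3 (cplxmx x) (cplxmx u); rewrite cplxmx_eq0 x0 => /(_ isT).
  have -> : cplxmx D + t%:C%:M = cplxmx (D + t%:M).
    by rewrite cplxmxD /cplxmx map_scalar_mx.
  rewrite -!cplxmxM -!cplxmxD cdot_cplx re2B re2_cdot_cplx re2_Re /=.
  by rewrite -rmorphB ltcR -mulrBr pmulr_rlt0.
- move=> u; rewrite mulmxDl rdotDr mul_scalar_mx rdotZr addr_ge0 //.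
    have [->|u0] := eqVneq u 0; first by rewrite rdot0l.
    have /pdmxP[_ /(_ u u0)] := hD.
    rewrite mulmxDl rdotDr -rdotMl [rdot (D *m u) u]rdotC => h; lra.
  by rewrite mulr_ge0 ?rdot_ge0 // ltW.
Unshelve. all: by end_near. Qed.

End Necessity.

(** * Port-Hamiltonian systems are limits of ESPR systems *)

Section Perturbation.
Local Open Scope complex_scope.
Local Open Scope ring_scope.
Context {R : realType} {n m : nat}.
Implicit Types (s d : system R n m).

Definition sys_move s d (t : R) : system R n m :=
  System (sysE s + t *: sysE d) (sysA s + t *: sysA d) (sysB s + t *: sysB d)
         (sysC s + t *: sysC d) (sysD s + t *: sysD d).

(** Some arbitrarily small [t] in one fixed direction is asked for, not all small [t]: the step to a
    simple spectrum has to avoid finitely many values. *)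
Definition approx (S1 S2 : set (system R n m)) : Prop :=
  forall s, S1 s -> exists d, forall e : R, 0 < e ->
    exists2 t, 0 < t < e & S2 (sys_move s d t).

Lemma approx_all (S1 S2 : set (system R n m)) :
  (forall s, S1 s -> exists d, forall t, 0 < t -> S2 (sys_move s d t)) ->
  approx S1 S2.
Proof.
move=> h s /h[d hd]; exists d => e e0; exists (e / 2); last by apply: hd; lra.
by apply/andP; split; lra.
Qed.

Lemma frobenius_sqr k l (M : 'M[R]_(k, l)) :
  frobenius M ^+ 2 = \sum_i \sum_j M i j ^+ 2.
Proof.
by rewrite sqr_sqrtr // sumr_ge0 // => i _; apply: sumr_ge0 => j _; apply: sqr_ge0.
Qed.

Lemma frobenius_move k l (M N D : 'M[R]_(k, l)) : exists b c : R, forall t,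
  frobenius (M - (N + t *: D)) ^+ 2
  = frobenius (M - N) ^+ 2 + t * b + t ^+ 2 * c.
Proof.
exists (\sum_i \sum_j - (2 * (M i j - N i j) * D i j)).
exists (\sum_i \sum_j D i j ^+ 2) => t; rewrite !frobenius_sqr.
rewrite !mulr_sumr -!big_split /=; apply: eq_bigr => i _.
rewrite !mulr_sumr -!big_split /=; apply: eq_bigr => j _.
by rewrite !mxE; ring.
Qed.

(** For [t < 1] the quadratic dependence bounds the change of [F] by [t] times a constant depending
    on [s] and [d]. *)
Lemma approx_inf (F : system R n m -> R) (S1 S2 : set (system R n m)) :
  (forall s d, exists b c, forall t,
     F (sys_move s d t) = F s + t * b + t ^+ 2 * c) ->
  approx S1 S2 ->
  (ereal_inf [set (F s)%:E | s in S2] <= ereal_inf [set (F s)%:E | s in S1])%E.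
Proof.
move=> hF h; apply/ereal_infP => _ [s /h[d hd] <-].
apply/lee_addgt0Pr => e e0; have [b [c hbc]] := hF s d.
pose a := `|b| + `|c| + 1.
have a0 : 0 < a by rewrite ltr_wpDl // addr_ge0.
have [|t /andP[t0]] := hd (Num.min 1 (e / a)).
  by rewrite lt_min ltr01 divr_gt0.
rewrite lt_min => /andP[t1 te] hS2.
apply: (@le_trans _ _ (F (sys_move s d t))%:E).
  by apply: ereal_inf_lbound; exists (sys_move s d t).
rewrite -EFinD lee_fin hbc -addrA lerD2l.
rewrite ltr_pdivlMr // in te; apply: le_trans (ltW te).
rewrite expr2 -mulrA -mulrDr ler_pM2l // /a -addrA.
have hb : b <= `|b| by apply: ler_norm.
have hc : t * c <= `|c|.
  apply: le_trans (ler_norm _) _; rewrite normrM gtr0_norm //.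
  by rewrite ler_piMl // ltW.
lra.
Qed.

Definition ph_system (M J Rm Q : 'M[R]_n) (F P : 'M[R]_(n, m)) (S N : 'M[R]_m) :=
  System M ((J - Rm) *m Q) (F - P) ((F + P)^T *m Q) (S + N).

(** The last clause says that the form of [M^T *m Q] is degenerate only on the common kernel of [M]
    and [Q]; this is what lets the next step make [Q] invertible. *)
Definition PH_observable : set (system R n m) :=
  [set s | exists M J Rm Q F P S N, [/\ J^T = - J, N^T = - N, psdmx (M^T *m Q),
     psdmx (block_mx Rm P P^T S) & s = ph_system M J Rm Q F P S N] /\
     forall x : 'cV_n, rdot (M *m x) (Q *m x) = 0 -> M *m x = 0 /\ Q *m x = 0].

Definition PH_unit : set (system R n m) :=
  [set s | exists M J Rm Q F P S N, [/\ J^T = - J, N^T = - N, psdmx (M^T *m Q),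
     psdmx (block_mx Rm P P^T S) & s = ph_system M J Rm Q F P S N] /\
     Q \in unitmx].

Definition PH_strict : set (system R n m) :=
  [set s | exists M J Rm Q F P S N c, [/\ J^T = - J, N^T = - N, pdmx (M^T *m Q),
     psdmx (block_mx Rm P P^T S - c%:M) & s = ph_system M J Rm Q F P S N] /\
     Q \in unitmx /\ 0 < c].

(** Replacing [(M, Q)] by [(M + t *: Q, Q + t *: M)] keeps the product symmetric and adds [t] times
    both squared norms to its form. *)
Lemma approx_PH_observable : approx S_PHbar PH_observable.
Proof.
apply: approx_all => _ [M [J [Rm [Q [F [P [S [N [hJ hN hMQ hW ->]]]]]]]]].
exists (System Q ((J - Rm) *m M) 0 ((F + P)^T *m M) 0) => t t0.
have [hs hp] := (psdmxP _).1 hMQ.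
have hQM : Q^T *m M = M^T *m Q by rewrite -hs trmx_mul trmxK.
have hform (x : 'cV_n) : rdot ((M + t *: Q) *m x) ((Q + t *: M) *m x)
    = (1 + t ^+ 2) * rdot (M *m x) (Q *m x) + t * rdot (Q *m x) (Q *m x)
      + t * rdot (M *m x) (M *m x).
  rewrite !mulmxDl -!scalemxAl !(rdotDl, rdotDr, rdotZl, rdotZr).
  by rewrite [rdot (Q *m x) (M *m x)]rdotC; ring.
have hge (x : 'cV_n) : 0 <= rdot (M *m x) (Q *m x).
  by rewrite rdotMl mulmxA hp.
exists (M + t *: Q), J, Rm, (Q + t *: M), F, P, S, N; split.
  split=> //.
  - apply/psdmxP; split.
      have trD (X Y : 'M[R]_n) : (X + t *: Y)^T = X^T + t *: Y^T.
        by rewrite linearD /= linearZ.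
      rewrite trmx_mul trmxK !trD !(mulmxDl, mulmxDr) -!scalemxAl -!scalemxAr hQM.
      by rewrite -!addrA; congr (_ + _); rewrite addrCA.
    move=> x; rewrite -mulmxA rdotMr trmxK hform.
    have := hge x; have := rdot_ge0 (Q *m x); have := rdot_ge0 (M *m x).
    move: (rdot _ _) (rdot _ _) (rdot _ _) => a b h a0 b0 h0.
    by rewrite !addr_ge0 // mulr_ge0 // ?ltW // addr_gt0 // exprn_gt0.
  - by rewrite /sys_move /ph_system /= !scaler0 !addr0 !mulmxDr !scalemxAr.
move=> x; rewrite hform => h.
have [a0 b0] : rdot (M *m x) (M *m x) = 0 /\ rdot (Q *m x) (Q *m x) = 0.
  have := hge x; have := rdot_ge0 (Q *m x); have := rdot_ge0 (M *m x).
  move: (rdot (M *m x) (Q *m x)) (rdot (M *m x) (M *m x)) (rdot (Q *m x) (Q *m x)) h.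
  move=> h a b e a0 b0 h0.
  have h1 : 0 <= (1 + t ^+ 2) * h by rewrite mulr_ge0 // addr_ge0 // sqr_ge0.
  have h2 : 0 <= t * a by rewrite mulr_ge0 // ltW.
  have h3 : 0 <= t * b by rewrite mulr_ge0 // ltW.
  have {}h2 : t * a = 0 by lra.
  have {}h3 : t * b = 0 by lra.
  by move: h2 h3 => /eqP + /eqP; rewrite !mulf_eq0 (gt_eqF t0) /= => /eqP -> /eqP ->.
move/eqP: a0; move/eqP: b0; rewrite !rdot_eq0 => /eqP b0 /eqP a0.
by rewrite !mulmxDl -!scalemxAl a0 b0 scaler0 addr0.
Qed.

(** With [M = L *m pid_mx r *m T], the transposed inverse of [L] makes the complementary columns
    orthogonal to the range of [M], and [T] keeps [U] injective on the kernel of [M]. *)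
Lemma complement_of_range (M : 'M[R]_n) : exists2 U : 'M[R]_n, M^T *m U = 0 &
  forall x : 'cV_n, M *m x = 0 -> U *m x = 0 -> x = 0.
Proof.
pose L := col_ebase M; pose T := row_ebase M; pose r := \rank M.
have hM : M = L *m pid_mx r *m T by rewrite mulmx_ebase.
have hL : L \in unitmx by apply: col_ebase_unit.
have hT : T \in unitmx by apply: row_ebase_unit.
exists ((invmx L)^T *m copid_mx r *m T).
  rewrite {1}hM !trmx_mul tr_pid_mx -!mulmxA [L^T *m _]mulmxA -trmx_mul mulVmx //.
  rewrite trmx1 mul1mx [pid_mx _ *m _]mulmxA mul_pid_mx_copid ?rank_leq_row //.
  by rewrite mul0mx mulmx0.
move=> x; rewrite {1}hM -!mulmxA => /(congr1 (mulmx (invmx L))).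
rewrite mulKmx // mulmx0 => h1 /(congr1 (mulmx L^T)).
rewrite trmx_inv mulKVmx ?unitmx_tr // mulmx0 /copid_mx mulmxBl mul1mx h1 subr0.
by move/(congr1 (mulmx (invmx T))); rewrite mulKmx // mulmx0.
Qed.

(** Adding [t *: U] to [Q] leaves [M^T *m Q] unchanged. A kernel vector of the sum is therefore
    degenerate for this form, hence killed by [M] and [Q], then by [U]. *)
Lemma approx_PH_unit : approx PH_observable PH_unit.
Proof.
apply: approx_all => _ [M [J [Rm [Q [F [P [S [N [[hJ hN hMQ hW ->] hobs]]]]]]]]].
have [U hU1 hU2] := complement_of_range M.
exists (System 0 ((J - Rm) *m U) 0 ((F + P)^T *m U) 0) => t t0.
exists M, J, Rm, (Q + t *: U), F, P, S, N; split.
  split=> //; first by rewrite mulmxDr -scalemxAr hU1 scaler0 addr0.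
  by rewrite /sys_move /ph_system /= !scaler0 !addr0 !mulmxDr !scalemxAr.
rewrite -unitmx_tr -row_free_unit -kermx_eq0; apply/rowV0P => v /sub_kermxP hv.
apply: trmx_inj; rewrite trmx0; set x := v^T.
have hx : (Q + t *: U) *m x = 0.
  by rewrite -[LHS]trmxK trmx_mul trmxK hv trmx0.
have [Mx Qx] : M *m x = 0 /\ Q *m x = 0.
  apply: hobs; rewrite rdotMl mulmxA -[M^T *m Q]addr0 -(scaler0 _ t) -hU1.
  by rewrite scalemxAr -mulmxDr -mulmxA hx mulmx0 rdot0r.
apply: hU2 => //; move/eqP: hx.
by rewrite mulmxDl Qx add0r -scalemxAl scaler_eq0 (gt_eqF t0) => /eqP.
Qed.

(** Moving [M] by [t *: Q] adds the definite [t *: (Q^T *m Q)]; adding [t] to R and S shifts the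
    whole dissipation block, so the margin is [t]. *)
Lemma approx_PH_strict : approx PH_unit PH_strict.
Proof.
apply: approx_all => _ [M [J [Rm [Q [F [P [S [N [[hJ hN hMQ hW ->] hQ]]]]]]]]].
exists (System Q (- Q) 0 0 1%:M) => t t0.
exists (M + t *: Q), J, (Rm + t%:M), Q, F, P, (S + t%:M), N, t; split=> //.
split=> //.
- have [hs hp] := (psdmxP _).1 hMQ.
  apply/pdmxP; split.
    rewrite linearD /= linearZ /= mulmxDl linearD /= hs -scalemxAl linearZ /=.
    by rewrite trmx_mul trmxK.
  move=> x x0; rewrite linearD /= linearZ /= !mulmxDl -!scalemxAl rdotDr rdotZr.
  rewrite ltr_wpDl ?hp // mulr_gt0 // -mulmxA -rdotMl rdot_gt0.
  by apply: contraNneq x0 => h; rewrite -[x](mulKmx hQ) h mulmx0.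
- by rewrite scalar_mx_block opp_block_mx add_block_mx !addrK !oppr0 !addr0.
- rewrite /sys_move /ph_system /= !scaler0 !addr0; congr System.
    by rewrite opprD addrA [in RHS]mulmxBl mul_scalar_mx scalerN.
  by rewrite scalemx1 addrAC.
Qed.

End Perturbation.

(** * Small perturbations with simple spectrum *)

Lemma poly_nonroot_small (R : realFieldType) (p : {poly R}) (e : R) :
  p != 0 -> 0 < e -> exists2 t, 0 < t < e & ~~ root p t.
Proof.
(* More candidates than possible roots; the shift by 2 keeps each strictly below [e]. *)
move=> p0 e0; pose f k : R := e / k.+2%:R.
have f_inj : injective f.
  move=> i j /(mulfI (lt0r_neq0 e0)) /invr_inj /eqP.
  by rewrite eqr_nat => /eqP[].
pose rs := [seq f i | i <- iota 0 (size p)].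
have : ~~ all (root p) rs.
  apply/negP => h; have := max_poly_roots p0 h.
  by rewrite map_inj_uniq // iota_uniq size_map size_iota ltnn => /(_ isT).
rewrite -has_predC => /hasP[_ /mapP[i _ ->] /= hr]; exists (f i) => //.
rewrite /f divr_gt0 //= ltr_pdivrMr // ltr_pMr //.
by rewrite ltr1n.
Qed.

(** Resultants commute with evaluation when leading coefficients survive it; for the derivative this
    coefficient is a nonzero constant. *)
Lemma lead_coef_deriv_char_poly (K : idomainType) n (A : 'M[K]_n.+1) :
  n.+1%:R != 0 :> K -> lead_coef (char_poly A)^`() = n.+1%:R.
Proof.
move=> h; have hm := char_poly_monic A; have hs := size_char_poly A.
have c : (char_poly A)^`()`_n = n.+1%:R.
  by rewrite coef_deriv; move: hm; rewrite monicE lead_coefE hs /= => /eqP ->.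
have s : size (char_poly A)^`() = n.+1.
  apply/anti_leq/andP; split; last first.
    by apply: contraR h; rewrite -leqNgt -c => /leq_sizeP ->.
  by rewrite -ltnS -hs lt_size_deriv // monic_neq0.
by rewrite lead_coefE s.
Qed.

(* The discriminant of the characteristic polynomial is a polynomial in [t] that
   does not vanish at [t = 1]. *)
Lemma separable_char_poly_small (R : realFieldType) n (A : 'M[R]_n) (e : R) :
  0 < e -> exists2 t, 0 < t < e &
  separable_poly (char_poly (A + t *: (diag_mx (\row_i (i : nat)%:R) - A))).
Proof.
move=> e0; case: n A => [|n] A.
  exists (e / 2); first by apply/andP; split; lra.
  by rewrite /char_poly det_mx00 unlock coprime1p.
set Delta := diag_mx _.
pose P : 'M[{poly R}]_n.+1 := map_mx polyC A + 'X *: map_mx polyC (Delta - A).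
have PE t : map_mx (horner_eval t) P = A + t *: (Delta - A).
  by apply/matrixP => i j; rewrite !mxE /horner_eval !hornerE.
pose rho := resultant (char_poly P) (char_poly P)^`().
have nz (K : numDomainType) : n.+1%:R != 0 :> K by rewrite pnatr_eq0.
have nzP : n.+1%:R != 0 :> {poly R} by rewrite -polyC_natr polyC_eq0.
have rhoE t : ~~ root rho t = separable_poly (char_poly (A + t *: (Delta - A))).
  have := @map_resultant R R (horner_eval t) (char_poly P) (char_poly P)^`().
  rewrite (monicP (char_poly_monic P)) lead_coef_deriv_char_poly // rmorph1.
  rewrite rmorph_nat => /(_ (oner_neq0 _) (nz _)).
  rewrite -deriv_map map_char_poly PE -/rho => h.
  rewrite /root -[rho.[t]]/(horner_eval t rho) h resultant_eq0.
  rewrite unlock coprimep_def -leqNgt.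
  have {}h : (0 < size (gcdp (char_poly (A + t *: (Delta - A)))
                         (char_poly (A + t *: (Delta - A)))^`()))%N.
    by rewrite size_poly_gt0 gcdp_eq0 negb_and monic_neq0 // char_poly_monic.
  by rewrite eqn_leq h andbT.
have rho0 : rho != 0.
  suff : ~~ root rho 1 by apply: contraNneq => ->; rewrite root0.
  (* At [t = 1] the matrix is [Delta], whose diagonal entries are distinct. *)
  rewrite rhoE scale1r addrC subrK char_poly_trig ?diag_mx_is_trig //.
  rewrite -(big_map (fun i => Delta i i) xpredT (fun x => 'X - x%:P)).
  rewrite separable_prod_XsubC map_inj_uniq ?index_enum_uniq //.
  move=> i j; rewrite !mxE !eqxx => /eqP; rewrite eqr_nat => /eqP.
  exact: val_inj.
have [t te ht] := poly_nonroot_small rho0 e0.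
by exists t => //; rewrite -rhoE.
Qed.

Lemma separable_char_poly_diagonalizable (C : closedFieldType) n (A : 'M[C]_n) :
  separable_poly (char_poly A) ->
  exists T d, T \in unitmx /\ A = invmx T *m diag_mx d *m T.
Proof.
case: n A => [|n] A hA.
  by exists 1%:M, 0; split; [exact: unitmx1 | rewrite flatmx0 [RHS]flatmx0].
have [rs] := closed_field_poly_normal (char_poly A).
rewrite (monicP (char_poly_monic A)) scale1r => hrs.
have [T hT] : diagonalizable A.
  apply/diagonalizableP; exists rs; last by rewrite -hrs mxminpoly_dvd_char.
  by rewrite -separable_prod_XsubC -hrs.
case/(diagonalizable_forLR hT) => d ->; exists T, d; split=> //.
by rewrite mxpoly.conjumx ?unitmx_inv // invmxK.
Qed.

Section Step.
Local Open Scope complex_scope.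
Local Open Scope ring_scope.
Context {R : realType} {n m : nat}.

Definition PH_simple : set (system R n m) :=
  [set s | PH_strict s /\ exists T d, T \in unitmx /\
     cplxmx (invmx (sysE s) *m sysA s) = invmx T *m diag_mx d *m T].

Lemma rdot_form_bounded k (M : 'M[R]_k) :
  exists2 b, 0 < b & forall x, `|rdot x (M *m x)| <= b * rdot x x.
Proof.
have [c0 hc0 hb] := mulmx_bounded (cplxmx M).
pose c := complex.Re c0.
have cE : c0 = (c%:C)%C by rewrite /c RRe_real // gtr0_real.
have hM x : rdot (M *m x) (M *m x) <= c * rdot x x.
  have := hb (cplxmx x); rewrite cE -cplxmxM !cdot_cplx -rmorphM.
  by rewrite lecR.
have c0' : 0 < c by move: hc0; rewrite cE ltcR.
exists (1 + c) => [|x]; first lra.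
have h1 := rdot_ge0 (x - M *m x); have h2 := rdot_ge0 (x + M *m x).
move: h1 h2; rewrite !(rdotDl, rdotDr, rdotNl, rdotNr) [rdot (M *m x) x]rdotC.
have := hM x; have := rdot_ge0 x; have := rdot_ge0 (M *m x).
move=> ? ? ? ? ?; rewrite ler_norml; apply/andP; split; lra.
Qed.

Lemma pdmx_unit (M Q : 'M[R]_n) : pdmx (M^T *m Q) -> M \in unitmx.
Proof.
move=> /pdmxP[hs hp]; rewrite -unitmx_tr -row_free_unit -kermx_eq0.
apply/rowV0P => v /sub_kermxP hv; apply/eqP/negPn/negP => v0.
have vT0 : v^T != 0 by apply: contraNneq v0 => h; rewrite -[v]trmxK h trmx0.
have := hp _ vT0; rewrite -mulmxA -rdotMl -[M *m _]trmxK trmx_mul trmxK hv.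
by rewrite trmx0 rdot0l ltxx.
Qed.

(** Only the A-component moves, so that [invmx M *m A] heads for a diagonal matrix with distinct
    entries. Written as [Z *m Q], the direction splits: the skew part of [Z] goes into J, the
    symmetric part into R. For [t] below [c / (2 * b)] half of the margin [c] remains. *)
Lemma approx_PH_simple : approx PH_strict PH_simple.
Proof.
move=> _ [M [J [Rm [Q [F [P [S [N [c [[hJ hN hMQ hW ->] [hQ c0]]]]]]]]]]].
have hM := pdmx_unit hMQ.
pose A := (J - Rm) *m Q; pose Delta : 'M[R]_n := diag_mx (\row_i (i : nat)%:R).
exists (System 0 (M *m Delta - A) 0 0 0) => e e0.
pose Z := (M *m Delta - A) *m invmx Q.
have [b b0 hb] := rdot_form_bounded Z.
pose h : R := 2^-1.
have [|t /andP[t0]] :=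
    @separable_char_poly_small R n (invmx M *m A) (Num.min e (c / (2 * b))).
  by rewrite lt_min e0 divr_gt0 // mulr_gt0.
rewrite lt_min => /andP[te tb] hsep; exists t; first by rewrite t0.
have half (X : 'M[R]_n) : h *: (X - X^T) + h *: (X + X^T) = X.
  rewrite -scalerDr addrACA addNr addr0 -mulr2n -scaler_nat scalerA.
  by rewrite mulVf ?scale1r ?pnatr_eq0.
have trZ a (X : 'M[R]_n) : (a *: X)^T = a *: X^T by rewrite linearZ.
split.
  exists M, (J + t *: (h *: (Z - Z^T))), (Rm - t *: (h *: (Z + Z^T))), Q, F, P, S, N.
  exists (c / 2); split; last by split=> //; lra.
  split=> //.
  - rewrite linearD /= hJ !trZ linearB /= trmxK opprD; congr (_ + _).
    by rewrite -opprB !scalerN.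
  - have [hs hp] := (psdmxP _).1 hW.
    have hRm : Rm^T = Rm.
      move: hs; rewrite linearB /= tr_block_mx tr_scalar_mx => /addIr.
      by case/eq_block_mx.
    have hS : S^T = S.
      move: hs; rewrite linearB /= tr_block_mx tr_scalar_mx => /addIr.
      by case/eq_block_mx.
    apply/psdmxP; split.
      rewrite linearB /= tr_block_mx tr_scalar_mx trmxK hS.
      congr (block_mx _ _ _ _ - _).
      by rewrite linearB /= !trZ linearD /= trmxK hRm [Z^T + _]addrC.
    move=> z; have := hp z; rewrite !mulmxBl !mul_scalar_mx -[z]vsubmxK.
    set y := usubmx z; set u := dsubmx z.
    have := hb y; rewrite ler_norml => /andP[_ hby].
    have hy := rdot_ge0 y; have hu := rdot_ge0 u.
    have ht : t * rdot y (Z *m y) <= c / 2 * rdot y y.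
      apply: (@le_trans _ _ (t * (b * rdot y y))); first by rewrite ler_pM2l.
      rewrite mulrA ler_wpM2r // ltW //.
      by move: tb; rewrite ltr_pdivlMr ?mulr_gt0 // => tb; lra.
    have hZ : rdot y (t *: (h *: (Z + Z^T)) *m y) = t * rdot y (Z *m y).
      rewrite -!scalemxAl !rdotZr mulmxDl rdotDr -[rdot y (Z^T *m y)]rdotMl.
      by rewrite [rdot (Z *m y) y]rdotC /h; lra.
    rewrite !mul_block_col mulmxBl.
    rewrite !(rdotDr, rdotNr, rdotZr, rdot_col) hZ => H.
    have hcu : 0 <= c * rdot u u by rewrite mulr_ge0 // ltW.
    lra.
  - rewrite /sys_move /ph_system /= !scaler0 !addr0; congr System.
    rewrite opprB [t *: _ - Rm]addrC addrACA -scalerDr half.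
    rewrite [in RHS]mulmxDl -scalemxAl.
    by rewrite mulmxKV.
rewrite /= scaler0 addr0 -/A.
apply: separable_char_poly_diagonalizable.
rewrite /cplxmx -map_char_poly separable_map.
by rewrite mulmxDr -scalemxAr mulmxBr mulKmx.
Qed.

End Step.

(** * The energy identity and its consequences *)

Section Sufficiency.
Local Open Scope complex_scope.
Local Open Scope ring_scope.
Context {R : realType}.

Lemma castmx_block_thin (K : nzRingType) n (e : (n + 0)%N = n) (A : 'M[K]_n) N :
  castmx (e, e) (block_mx A 0 0 (N : 'M_0)) = A.
Proof.
apply/matrixP => i j; rewrite castmxE /block_mx.
have cast_lshift (k : 'I_n) : cast_ord (esym e) k = lshift 0 k.
  by apply: val_inj.
by rewrite !cast_lshift col_mxEu row_mxEl.
Qed.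

Lemma pencil_index0 n (E A : 'M[R]_n) (T : 'M[R[i]]_n) (d : 'rV[R[i]]_n) :
  E \in unitmx -> T \in unitmx ->
  cplxmx (invmx E *m A) = invmx T *m diag_mx d *m T -> pencil_index E A 0.
Proof.
move=> hE hT hA; exists n, 0%N, (addn0 n), (cplxmx E *m invmx T), T.
exists (diag_mx d), 0; rewrite ltnn; split; last by [].
split; first by rewrite unitmx_mul unitmx_inv hT map_unitmx hE.
- exact: hT.
- move=> i j; split=> [ij|ij _]; rewrite mxE.
    by left; rewrite -val_eqE /= ij ltn_eqF // mulr0n.
  by rewrite -val_eqE eq_sym; move/eqP/negPf: ij => ->; rewrite mulr0n.
- by split=> [[]//|]; exists 0%N; rewrite [LHS]flatmx0 [RHS]flatmx0.
have hEA : cplxmx A = cplxmx E *m invmx T *m diag_mx d *m T.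
  by rewrite -!mulmxA [invmx T *m _]mulmxA -hA -cplxmxM mulKVmx.
by rewrite !castmx_block_thin mulmx1 (mulmxKV hT); split; last exact: hEA.
Qed.

Lemma psd_cplx n (W : 'M[R]_n) (u : 'cV[R[i]]_n) : psdmx W ->
  0 <= cdot u (cplxmx W *m u).
Proof.
by move=> /psdmxP[hs hp]; rewrite cdot_sym_cplx // lecR addr_ge0.
Qed.

Lemma skew_cplx n (J : 'M[R]_n) (u : 'cV[R[i]]_n) : J^T = - J ->
  re2 (cdot u (cplxmx J *m u)) = 0.
Proof.
move=> hJ; rewrite /re2 cdotC [cdot (_ *m u) u]cdotMl cplxmx_ct hJ.
by rewrite /cplxmx map_mxN mulNmx cdotNr subrr.
Qed.

Lemma energy_bound (C : numClosedFieldType) (l h a b f p r s k : C) :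
  0 <= l + l^* -> 0 <= h -> a + a^* = 0 -> b + b^* = 0 -> r^* = r -> s^* = s ->
  a - r + (f - p) = l * h -> 0 <= r + p + (p^* + s) - k ->
  2 * k <= re2 (f^* + p^* + (s + b)).
Proof.
move=> hl h0 ha hb hr hs hlh hk.
have hh : h^* = h by rewrite conj_Creal // ger0_real.
have := congr1 Num.conj hlh; rewrite !(rmorphD, rmorphN, rmorphM) /= hh hr => hlh'.
have lh : 0 <= (l + l^*) * h by rewrite mulr_ge0.
rewrite -subr_ge0 /re2 !rmorphD /= !conjCK hs.
have a'E : a^* = - a by apply/eqP; rewrite -addr_eq0 addrC ha.
have b'E : b^* = - b by apply/eqP; rewrite -addr_eq0 addrC hb.
have -> : f^* + p^* + (s + b) + (f + p + (s + b^*)) - 2 * k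
    = 2 * (r + p + (p^* + s) - k) + (l + l^*) * h.
  by rewrite [(l + l^*) * h]mulrDl -hlh -hlh' a'E b'E; ring.
by rewrite addr_ge0 // mulr_ge0.
Qed.

Lemma ph_energy n m (M J Rm Q : 'M[R]_n) (F P : 'M[R]_(n, m)) (S N : 'M[R]_m)
    (c : R) (l : R[i]) (x : 'cV[R[i]]_n) (u : 'cV[R[i]]_m) :
  let sys := ph_system M J Rm Q F P S N in
  J^T = - J -> N^T = - N -> psdmx (M^T *m Q) ->
  psdmx (block_mx Rm P P^T S - c%:M) ->
  0 <= l + l^* ->
  l *: (cplxmx (sysE sys) *m x) = cplxmx (sysA sys) *m x + cplxmx (sysB sys) *m u ->
  2 * (c%:C * (cdot (cplxmx Q *m x) (cplxmx Q *m x) + cdot u u))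
  <= re2 (cdot u (cplxmx (sysC sys) *m x + cplxmx (sysD sys) *m u)).
Proof.
move=> /= hJ hN hMQ hW hl hx; set y := cplxmx Q *m x.
pose z := col_mx y u.
have W_ge0 := psd_cplx z hW.
have cplxB k1 k2 (X Y : 'M[R]_(k1, k2)) : cplxmx (X - Y) = cplxmx X - cplxmx Y.
  by rewrite /cplxmx map_mxB.
have cblock : cplxmx (block_mx Rm P P^T S)
    = block_mx (cplxmx Rm) (cplxmx P) (cplxmx P^T) (cplxmx S).
  by rewrite /cplxmx map_block_mx.
have cscal k (a : R) : cplxmx (a%:M : 'M_k) = (a%:C)%:M.
  by rewrite /cplxmx map_scalar_mx.
have hP : cdot u (cplxmx P^T *m y) = (cdot y (cplxmx P *m u))^*.
  by rewrite cdotC cdotMl cplxmx_ct.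
have hF : cdot u (cplxmx F^T *m y) = (cdot y (cplxmx F *m u))^*.
  by rewrite cdotC cdotMl cplxmx_ct.
have hRm : Rm^T = Rm /\ S^T = S.
  case: hW => + _; rewrite linearB /= tr_block_mx tr_scalar_mx => /addIr.
  by case/eq_block_mx.
have real_form k (X : 'M[R]_k) v : X^T = X ->
    (cdot v (cplxmx X *m v))^* = cdot v (cplxmx X *m v).
  by move=> hX; rewrite cdot_herm // cplxmx_ct hX.
have hyR := real_form _ _ y hRm.1; have huS := real_form _ _ u hRm.2.
have hyy : cdot y (l *: (cplxmx M *m x)) = l * cdot x (cplxmx (M^T *m Q) *m x).
  rewrite cdotZr; congr (_ * _); rewrite -[LHS]cdotC [cdot (_ *m x) y]cdotMl.
  by rewrite cplxmx_ct /y mulmxA -cplxmxM real_form //; case: hMQ.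
have h_ge0 := psd_cplx x hMQ.
move: hyy; rewrite hx; set h := cdot x _ in h_ge0 *.
have -> : cplxmx ((J - Rm) *m Q) *m x = (cplxmx J - cplxmx Rm) *m y.
  by rewrite cplxmxM cplxB mulmxA.
have -> : cplxmx ((F + P)^T *m Q) *m x = (cplxmx F^T + cplxmx P^T) *m y.
  by rewrite cplxmxM linearD /= cplxmxD mulmxA.
rewrite cplxB !cplxmxD !(mulmxDl, mulNmx) !(cdotDr, cdotNr) => hlh.
rewrite hP hF.
apply: (energy_bound hl h_ge0 (skew_cplx y hJ) (skew_cplx u hN) hyR huS hlh).
move: W_ge0; rewrite cplxB cblock cscal /z mulmxBl mul_scalar_mx mul_block_col.
by rewrite cdotBr cdotZr !cdot_col !cdotDr hP.
Qed.

Lemma PH_simple_sub n m (sys : system R n m) :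
  PH_simple sys -> S_e sys /\ S_PR sys.
Proof.
case=> [[M [J [Rm [Q [F [P [S [N [c [[hJ hN hMQ hW ->] [hQ c0]]]]]]]]]]]].
set s := ph_system _ _ _ _ _ _ _ _ => -[T [d [hT hdiag]]].
have hM := pdmx_unit hMQ.
have hMQ' : psdmx (M^T *m Q).
  have [h1 h2] := (pdmxP _).1 hMQ; apply/psdmxP; split=> // x.
  by have [->|/h2/ltW//] := eqVneq x 0; rewrite rdot0l.
pose E := cplxmx (sysE s); pose A := cplxmx (sysA s).
have energy l x u := @ph_energy n m M J Rm Q F P S N c l x u hJ hN hMQ' hW.
have cc : 0 < 2 * c%:C :> R[i] by rewrite mulr_gt0 // ltcR.
(* At zero input the energy bound forces [Q x = 0], so the pencil has no eigenvalue in the closed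
   right half plane. *)
have reg l : 0 <= complex.Re l -> l *: E - A \in unitmx.
  rewrite -addJ_ge0 => hl; rewrite -unitmx_tr -row_free_unit -kermx_eq0.
  apply/rowV0P => v /sub_kermxP hv; apply: trmx_inj; rewrite trmx0.
  set x := v^T.
  have hx : (l *: E - A) *m x = 0 by rewrite -[LHS]trmxK trmx_mul trmxK hv trmx0.
  have := energy l x 0 hl; rewrite mulmx0 addr0 !cdot0l addr0 /re2 conjC0 addr0.
  move: hx => /eqP; rewrite mulmxBl subr_eq0 -scalemxAl => /eqP hx /(_ hx).
  rewrite mulrA pmulr_rle0 // => h; have : cdot (cplxmx Q *m x) (cplxmx Q *m x) = 0.
    by apply/eqP; rewrite eq_le h cdot_ge0.
  move/eqP; rewrite cdot_eq0 => /eqP h0.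
  have hQc : cplxmx Q \in unitmx by rewrite map_unitmx.
  by rewrite -[x](mulKmx hQc) h0 mulmx0.
have detE l : 0 <= complex.Re l -> \det (l *: E - A) != 0.
  by move=> /reg; rewrite unitmxE unitfE.
have hreg : regular_pencil (sysE s) (sysA s).
  by exists 0; apply: detE.
pose G := transfer_function s.
have GE l : 0 <= complex.Re l -> ~ mx_pole G l /\
    mx_eval G l = cplxmx (sysC s) *m invmx (l *: E - A) *m cplxmx (sysB s)
                  + cplxmx (sysD s).
  by move=> /detE; apply: transfer_functionE.
(* The bound is uniform in [l] on the closed half plane: it serves SPR on the axis and PR inside. *)
have G_pos l u : 0 <= complex.Re l ->
    2 * c%:C * cdot u u <= (u ^t* *m add_ctr (mx_eval G l) *m u) 0 0.
  move=> hl; have [_ ->] := GE l hl; set H := _ + cplxmx (sysD s).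
  have -> : (u ^t* *m add_ctr H *m u) 0 0 = re2 (cdot u (H *m u)).
    by rewrite /re2 cdotC [cdot (H *m u) u]cdotMl -cdotDr -mulmxDl /cdot mulmxA.
  pose x := invmx (l *: E - A) *m (cplxmx (sysB s) *m u).
  have hx : l *: (E *m x) = A *m x + cplxmx (sysB s) *m u.
    have : (l *: E - A) *m x = cplxmx (sysB s) *m u by rewrite mulKVmx // reg.
    by rewrite mulmxBl -scalemxAl => <-; rewrite addrC subrK.
  have -> : H *m u = cplxmx (sysC s) *m x + cplxmx (sysD s) *m u.
    by rewrite mulmxDl /x !mulmxA.
  have hl' : 0 <= l + l^* by rewrite addJ_ge0.
  apply: le_trans (energy l x u hl' hx).
  by rewrite mulrA ler_pM2l // lerDr cdot_ge0.
have ctr_herm (H : 'M[R[i]]_m) : (add_ctr H) ^t* = add_ctr H.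
  by rewrite /add_ctr ctmxD trmxCK addrC.
have hD : pdmx (sysD s + (sysD s)^T).
  apply/pdmxP; split; first by rewrite linearD /= trmxK addrC.
  move=> u u0; have [hs hp] := (psdmxP _).1 hW.
  have := hp (col_mx 0 u).
  rewrite mulmxBl mul_block_col mul_scalar_mx scale_col_mx opp_col_mx add_col_mx.
  rewrite rdot_col rdot0l add0r mulmx0 add0r rdotDr rdotNr rdotZr => h.
  have hcu : 0 < c * rdot u u by rewrite mulr_gt0 // rdot_gt0.
  rewrite mulmxDl rdotDr -[rdot u (_^T *m u)]rdotMl [rdot (_ *m u) u]rdotC /=.
  rewrite mulmxDl rdotDr.
  have : rdot u (N *m u) = 0.
    by have := rdotMl N u u; rewrite hN mulNmx rdotNr rdotC => hh; lra.
  move=> ->; lra.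
have spr : strictly_positive_real s.
  split=> // [l hl|w w0]; first by have [] := GE l hl.
  split=> // u u0; apply: lt_le_trans (G_pos (0 +i* w) u _); last by [].
  by rewrite mulr_gt0 // cdot_gt0.
split; last first.
  split=> // [l hl|l hl]; first by have [] := GE l (ltW hl).
  split=> // u; apply: le_trans (G_pos l u (ltW hl)).
  by rewrite mulr_ge0 ?cdot_ge0 // ltW.
split=> //.
  split=> //; first by exists 0%N => //; apply: pencil_index0 hT hdiag.
  by move=> l hl; rewrite ltNge; apply/negP => /detE; rewrite hl eqxx.
split=> //; exists (cplxmx (sysD s) : 'M[cplx_num R]_m).
  have := @transfer_cvg R n m E A (cplxmx (sysB s)) (cplxmx (sysC s))
    (cplxmx (sysD s)).
  move=> /(_ _ _)/= h; apply: cvg_trans (h _ _).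
  - apply: near_eq_cvg; near=> w.
    have hw : 0 <= complex.Re ((0 +i* w) : R[i]) by [].
    by rewrite (GE _ hw).2.
  - by rewrite map_unitmx.
  - by move=> w w0; apply: reg.
split=> // u u0.
have -> : (u ^t* *m add_ctr (cplxmx (sysD s)) *m u) 0 0
    = re2 (cdot u (cplxmx (sysD s) *m u)).
  by rewrite /re2 cdotC [cdot (_ *m u) u]cdotMl -cdotDr -mulmxDl /cdot mulmxA.
exact: cplx_pos.
Unshelve. all: by end_near. Qed.

End Sufficiency.

Lemma approx_S_e (R : realType) n m : approx (@S_e R n m) S_PHbar.
Proof.
apply: approx_all => s hs; exists (System 0 0 0 0 1%:M) => t t0.
by rewrite /sys_move /= !scaler0 !addr0 scalemx1; apply: S_e_PHbar.
Qed.

Theorem theorem7 (R : realType) (n m : nat) (E A : 'M[R]_n) (B : 'M[R]_(n, m))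
    (C : 'M[R]_(m, n)) (D : 'M[R]_m) :
  let F (s : system R n m) : R :=
    frobenius (A - sysA s) ^+ 2 + frobenius (B - sysB s) ^+ 2
    + frobenius (C - sysC s) ^+ 2 + frobenius (D - sysD s) ^+ 2
    + frobenius (E - sysE s) ^+ 2 in
  ereal_inf [set (F s)%:E | s in S_PHbar] = ereal_inf [set (F s)%:E | s in S_e]
  /\ (ereal_inf [set (F s)%:E | s in S_PR]
      <= ereal_inf [set (F s)%:E | s in S_PHbar])%E.
Proof.
move=> F.
have hF s d : exists b c, forall t, F (sys_move s d t) = F s + t * b + t ^+ 2 * c.
  have [bA [cA hA]] := frobenius_move A (sysA s) (sysA d).
  have [bB [cB hB]] := frobenius_move B (sysB s) (sysB d).
  have [bC [cC hC]] := frobenius_move C (sysC s) (sysC d).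
  have [bD [cD hD]] := frobenius_move D (sysD s) (sysD d).
  have [bE [cE hE]] := frobenius_move E (sysE s) (sysE d).
  exists (bA + bB + bC + bD + bE), (cA + cB + cC + cD + cE) => t.
  by rewrite /F /= hA hB hC hD hE; ring.
(* Ending in the intersection lets one chain of approximations yield both bounds, without deriving
   PR from ESPR. *)
have PHbar_le : (ereal_inf [set (F s)%:E | s in S_e `&` S_PR]
    <= ereal_inf [set (F s)%:E | s in S_PHbar])%E.
  apply: (le_trans _ (approx_inf hF approx_PH_observable)).
  apply: (le_trans _ (approx_inf hF approx_PH_unit)).
  apply: (le_trans _ (approx_inf hF approx_PH_strict)).
  apply: (le_trans _ (approx_inf hF approx_PH_simple)).
  by apply: ereal_inf_le_tmp; apply: image_subset => s /PH_simple_sub.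
split; last first.
  apply: (le_trans _ PHbar_le); apply: ereal_inf_le_tmp.
  by apply: image_subset; exact: subIsetr.
apply/eqP; rewrite eq_le; apply/andP; split.
  exact: approx_inf hF (approx_S_e (n:=n) (m:=m)).
apply: (le_trans _ PHbar_le); apply: ereal_inf_le_tmp.
by apply: image_subset; exact: subIsetl.
Qed.
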